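(* Let $n\ge 2$ be even, let $y\in\tilde I^{\mathsf{FPF}}_n$, and let $p,q\in\mathbb Z$ with $p<q=y(p)$. Then $$\sum_{z\in\Pi^-(y,p)}\hat F^{\mathsf{FPF}}_z=\sum_{z\in\Pi^+(y,q)}\hat F^{\mathsf{FPF}}_z.$$
   Context: The affine symmetric group $\tilde S_n$ is the group of bijections $\pi:\mathbb Z\to\mathbb Z$ with $\pi(i+n)=\pi(i)+n$ for all $i$ and $\pi(1)+\dots+\pi(n)=1+\dots+n$. $s_i$ ($i\in\mathbb Z$) interchanges $i+kn,i+1+kn$ for all $k$ and fixes other integers; $\tilde S_n$ is a Coxeter group with generators $s_1,\dots,s_n$ and length $\ell$. For $i<j$, $j\not\equiv i\pmod n$, $t_{ij}$ exchanges $i+kn$ and $j+kn$ for all $k$ and fixes other integers (these are the reflections). $\tilde I^{\mathsf{FPF}}_n$ is the set of $z\in\tilde S_n$ with $z(z(i))=i\ne z(i)$ for all $i$. Let $\Theta^+=s_1s_3\cdots s_{n-1}$, $\Theta^-=s_2s_4\cdots s_n$; every $z\in\tilde I^{\mathsf{FPF}}_n$ is conjugate in $\tilde S_n$ to exactly one $\Theta\in\{\Theta^+,\Theta^-\}$, and $\mathcal A^{\mathsf{FPF}}(z)$ is the set of minimal-length elements of $\{w\in\tilde S_n: w^{-1}\Theta w=z\}$. Let $\hat\ell_{\mathsf{FPF}}(z)=\frac12(\ell(z)-\frac n2)$. Write $y\lessdot_F z$ if $z=tyt$ for some reflection $t$ and $\hat\ell_{\mathsf{FPF}}(z)=\hat\ell_{\mathsf{FPF}}(y)+1$.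 For $r\in\mathbb Z$: $\Pi^-(y,r)=\{z\in\tilde I^{\mathsf{FPF}}_n: y\lessdot_F z=t_{ir}yt_{ir}\text{ for some } i<r \text{ with } i\notin\{r,y(r)\}+n\mathbb Z\}$, $\Pi^+(y,r)=\{z\in\tilde I^{\mathsf{FPF}}_n: y\lessdot_F z=t_{rj}yt_{rj}\text{ for some } j>r \text{ with } j\notin\{r,y(r)\}+n\mathbb Z\}$. An element $\pi\in\tilde S_n$ is cyclically decreasing if it has a reduced expression $s_{i_1}\cdots s_{i_l}$ with $s_{i_j+1}\ne s_{i_k}$ for all $1\le j<k\le l$. The affine Stanley symmetric function is $F_\pi=\sum x_1^{\ell(\pi^1)}x_2^{\ell(\pi^2)}\cdots$, summed over all factorizations $\pi=\pi^1\pi^2\cdots$ into countably many (possibly identity) cyclically decreasing factors with $\ell(\pi)=\sum_k\ell(\pi^k)$. Finally $\hat F^{\mathsf{FPF}}_z=\sum_{\pi\in\mathcal A^{\mathsf{FPF}}(z)}F_\pi$. *)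

(* Defs.v *)
From HB Require Import structures.
From mathcomp Require Import all_boot all_order all_algebra.
From mathcomp Require Import finmap.
From mathcomp Require Import mathcomp_extra boolp classical_sets functions.
From mathcomp Require Import cardinality fsbigop.
From mathcomp Require Import zify ring.

Set Implicit Arguments.
Unset Strict Implicit.
Unset Printing Implicit Defensive.

Import Order.TTheory GRing.Theory Num.Theory.
Local Open Scope classical_set_scope.
Local Open Scope ring_scope.

Definition is_affine (n : nat) (f : int -> int) : Prop :=
  [/\ bijective f,
      forall i : int, f (i + n%:Z) = f i + n%:Z
    & \sum_(1 <= k < n.+1) f k%:Z = \sum_(1 <= k < n.+1) k%:Z].

Record affperm (n : nat) := AffPerm {
  afun :> int -> int;
  afunP : `[< is_affine n afun >] }.

HB.instance Definition _ n := [isSub for @afun n].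
HB.instance Definition _ n := [Choice of affperm n by <:].

Section GroupLaws.
Variable n : nat.

Lemma affpermP (u v : affperm n) : u =1 v -> u = v.
Proof. by move=> uv; apply: val_inj; apply/funext. Qed.

Lemma periodic_mul (f : int -> int) :
  (forall i, f (i + n%:Z) = f i + n%:Z) ->
  forall i k : int, f (i + k * n%:Z) = f i + k * n%:Z.
Proof.
move=> fn i k; elim/int_rec: k => [|k IH|k IH].
- by rewrite mul0r !addr0.
- by rewrite intS mulrDl mul1r addrCA addrC fn IH -addrA [_ * _ + _]addrC.
- have := fn (i + - k.+1%:Z * n%:Z).
  have -> : i + - k.+1%:Z * n%:Z + n%:Z = i + - k%:Z * n%:Z.
    by rewrite intS; ring.
  by rewrite IH => /esym/(canRL (addrK _)) ->; rewrite intS; ring.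
Qed.

Lemma sum_periodic (d f : int -> int) : bijective f ->
  (forall i, f (i + n%:Z) = f i + n%:Z) ->
  (forall i k : int, d (i + k * n%:Z) = d i) ->
  \sum_(1 <= k < n.+1) d (f k%:Z) = \sum_(1 <= k < n.+1) d k%:Z.
Proof.
move=> [g fK gK] fn dn; have fkn := periodic_mul fn.
rewrite !big_add1 /= !big_mkord.
case: (posnP n) => [n0|n_gt0]; first by rewrite !big1 // => -[i lti]; exfalso; move: lti; rewrite n0.
have nz : n%:Z != 0 by rewrite eqz_nat -lt0n.
have lt_s (i : 'I_n) : (`|((f i.+1%:Z - 1) %% n%:Z)%Z| < n)%N.
  by rewrite -ltz_nat gez0_abs ?modz_ge0 // ltz_mod.
pose s i := Ordinal (lt_s i).
have sE (i : 'I_n) : f i.+1%:Z = (s i).+1%:Z + ((f i.+1%:Z - 1) %/ n%:Z)%Z * n%:Z.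
  have es : (s i)%:Z = ((f i.+1%:Z - 1) %% n%:Z)%Z.
    by rewrite /= gez0_abs ?modz_ge0.
  rewrite -[(s i).+1]add1n PoszD es -addrA [X in 1 + X]addrC -divz_eq.
  by rewrite addrC subrK.
have s_inj : injective s.
  move=> i j sij; have := sE j; rewrite -sij => ej.
  have ei := sE i; apply: val_inj => /=.
  set a := ((f i.+1%:Z - 1) %/ n%:Z)%Z in ei.
  set b := ((f j.+1%:Z - 1) %/ n%:Z)%Z in ej.
  have : f i.+1%:Z = f (j.+1%:Z + (a - b) * n%:Z).
    by rewrite fkn ei ej; ring.
  move/(can_inj fK) => eij.
  have : (i%:Z = j%:Z %[mod n%:Z])%Z.
    have -> : i%:Z = (a - b) * n%:Z + j%:Z by move: eij; rewrite !intS; lia.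
    by rewrite modzMDl.
  by rewrite !modz_small ?ltz_nat ?ltn_ord // => -[].
rewrite [RHS](reindex_inj s_inj); apply: eq_bigr => i _.
by rewrite sE dn.
Qed.

Lemma disp_periodic (f : int -> int) :
  (forall i, f (i + n%:Z) = f i + n%:Z) ->
  forall i k : int, f (i + k * n%:Z) - (i + k * n%:Z) = f i - i.
Proof. by move=> fn i k; rewrite periodic_mul //; ring. Qed.

Lemma aff1_proof : `[< is_affine n id >].
Proof. by apply/asboolP; split => //; exists id. Qed.
Definition aff1 : affperm n := AffPerm aff1_proof.

Lemma affM_proof (u v : affperm n) : `[< is_affine n (u \o v) >].
Proof.
case: u v => [f /asboolP[fb fn fs]] [g /asboolP[gb gn gs]] /=.
apply/asboolP; split; first exact: bij_comp.
  by move=> i /=; rewrite gn fn.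
have := sum_periodic gb gn (disp_periodic fn).
by rewrite !sumrB fs subrr /= gs => /eqP; rewrite subr_eq0 => /eqP.
Qed.
(* Products are composites, the right factor acting first. *)
Definition affM (u v : affperm n) : affperm n := AffPerm (affM_proof u v).

Lemma affine_inv (u : affperm n) :
  {g : int -> int | is_affine n g /\ cancel g u}.
Proof.
apply: cid; case: u => [f /asboolP[fb fn fs]] /=.
case: (fb) => g fK gK; exists g; split=> //.
have gn i : g (i + n%:Z) = g i + n%:Z.
  by apply: (can_inj fK); rewrite gK fn gK.
have gb : bijective g by exists f.
split=> //.
have := sum_periodic gb gn (disp_periodic fn).
rewrite !sumrB fs subrr => /eqP; rewrite subr_eq0 => /eqP <-.
by apply: eq_bigr => i _; rewrite gK.
Qed.

Lemma affV_proof (u : affperm n) : `[< is_affine n (sval (affine_inv u)) >].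
Proof. by case: (affine_inv u) => g [ga _] /=; apply/asboolP. Qed.
Definition affV (u : affperm n) : affperm n := AffPerm (affV_proof u).

Lemma affMA : associative affM.
Proof. by move=> u v w; apply: affpermP. Qed.
Lemma aff1M : left_id aff1 affM.
Proof. by move=> u; apply: affpermP. Qed.
Lemma affM1 : right_id aff1 affM.
Proof. by move=> u; apply: affpermP. Qed.
Lemma affMV : right_inverse aff1 affV affM.
Proof.
by move=> u; apply: affpermP => i /=; case: (affine_inv u) => g [_ /= ->].
Qed.
Lemma affVM : left_inverse aff1 affV affM.
Proof.
move=> u; rewrite -[LHS]affM1 -(affMV (affV u)) affMA -[affM (affM _ u) _]affMA.
by rewrite affMV affM1.
Qed.

End GroupLaws.

HB.instance Definition _ n :=
  isGroup.Build (affperm n) (@affMA n) (@aff1M n) (@affM1 n)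
    (@affVM n) (@affMV n).

(* The first branch is a junk value: t_ij is only meaningful when i and j are
   not congruent modulo n. *)
Definition refl_fun (n : nat) (i j x : int) : int :=
  if (n%:Z %| j - i)%Z then x
  else if (n%:Z %| x - i)%Z then x + (j - i)
  else if (n%:Z %| x - j)%Z then x - (j - i)
  else x.

Lemma refl_fun_affine (n : nat) (i j : int) :
  `[< is_affine n (refl_fun n i j) >].
Proof.
apply/asboolP.
have [dij|ndij] := boolP (n%:Z %| j - i)%Z.
  have -> : refl_fun n i j = id by apply/funext => x; rewrite /refl_fun dij.
  by split=> //; exists id.
have per x : refl_fun n i j (x + n%:Z) = refl_fun n i j x + n%:Z.
  rewrite /refl_fun (negPf ndij) !(addrAC x n%:Z) !(rpredDr _ (dvdzz n%:Z)).
  by case: ifP => // _; case: ifP => // _; rewrite addrAC.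
have inv : involutive (refl_fun n i j).
  move=> x; rewrite /refl_fun (negPf ndij).
  case: (boolP (n%:Z %| x - i)%Z) => [xi|nxi].
    have -> : x + (j - i) - i = (x - i) + (j - i) by ring.
    have -> : x + (j - i) - j = x - i by ring.
    by rewrite (rpredDl _ xi) (negPf ndij) xi addrK.
  case: (boolP (n%:Z %| x - j)%Z) => [xj|nxj].
    have -> : x - (j - i) - i = x - j by ring.
    by rewrite xj subrK.
  by rewrite (negPf nxi) (negPf nxj).
have bij : bijective (refl_fun n i j) by exists (refl_fun n i j).
split=> //.
have := sum_periodic bij per (disp_periodic per).
set S := \sum_(1 <= k < n.+1) (refl_fun n i j k%:Z - k%:Z).
have -> : \sum_(1 <= k < n.+1) (refl_fun n i j (refl_fun n i j k%:Z) -
            refl_fun n i j k%:Z) = - S.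
  by rewrite -sumrN; apply: eq_bigr => k _; rewrite inv opprB.
move=> SE; have : S = 0 by lia.
by rewrite /S sumrB => /eqP; rewrite subr_eq0 => /eqP.
Qed.

Definition t_ (n : nat) (i j : int) : affperm n :=
  AffPerm (refl_fun_affine n i j).

Definition s_ (n : nat) (i : int) : affperm n := t_ n i (i + 1).

Definition is_reflection (n : nat) (t : affperm n) : Prop :=
  exists i j : int, [/\ i < j, ~~ (n%:Z %| j - i)%Z & t = t_ n i j].

(* Indices range over all integers; since s_ n i only depends on i modulo n,
   these are words in s_1, ..., s_n. *)
Definition word_prod (n : nat) (u : seq int) : affperm n :=
  (\prod_(i <- u) s_ n i)%g.

Definition reduced (n : nat) (u : seq int) : Prop :=
  forall v : seq int, word_prod n v = word_prod n u -> (size u <= size v)%N.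

(* The default value 0 is never used, as the s_ n i generate affperm n for
   n >= 2. *)
Definition len (n : nat) (w : affperm n) : nat :=
  xget 0%N [set size u | u in [set u | word_prod n u = w /\ reduced n u]].

Definition I_FPF (n : nat) : set (affperm n) :=
  [set z | forall i : int, z (z i) = i /\ i <> z i].

Definition Theta_plus (n : nat) : affperm n :=
  (\prod_(k < n./2) s_ n (k.*2.+1)%:Z)%g.

Definition Theta_minus (n : nat) : affperm n :=
  (\prod_(k < n./2) s_ n (k.*2.+2)%:Z)%g.

(* Exactly one of the two values of Theta is conjugate to z, so at most one
   contributes. *)
Definition atoms_FPF (n : nat) (z : affperm n) : set (affperm n) :=
  [set w | exists Theta : affperm n,
    [/\ Theta = Theta_plus n \/ Theta = Theta_minus n,
        (w^-1 * Theta * w)%g = z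
      & forall v : affperm n, (v^-1 * Theta * v)%g = z -> (len w <= len v)%N]].

Definition len_FPF (n : nat) (z : affperm n) : rat :=
  2%:R^-1 * ((len z)%:R - n%:R / 2%:R).

Definition covers_F (n : nat) (y z : affperm n) : Prop :=
  (exists t : affperm n, is_reflection t /\ z = (t * y * t)%g) /\
  len_FPF z = len_FPF y + 1.

Definition Pi_minus (n : nat) (y : affperm n) (r : int) : set (affperm n) :=
  [set z | I_FPF z /\ exists i : int,
    [/\ i < r, ~~ (n%:Z %| i - r)%Z, ~~ (n%:Z %| i - y r)%Z,
        covers_F y z & z = (t_ n i r * y * t_ n i r)%g]].

Definition Pi_plus (n : nat) (y : affperm n) (r : int) : set (affperm n) :=
  [set z | I_FPF z /\ exists j : int,
    [/\ r < j, ~~ (n%:Z %| j - r)%Z, ~~ (n%:Z %| j - y r)%Z,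
        covers_F y z & z = (t_ n r j * y * t_ n r j)%g]].

(* Formal power series over int in x_0, x_1, ... (x_k here being x_(k+1) in the
   usual numbering), as functions from exponent vectors to coefficients. *)
Definition monom : Type := {fsfun nat -> nat with 0%N}.
Definition fps : Type := monom -> int.
HB.instance Definition _ := GRing.Zmodule.on fps.

Definition xpow (e : nat -> nat) : fps := fun a => `[< a =1 e >]%:R.

Definition cyc_decreasing (n : nat) (w : affperm n) : Prop :=
  exists u : seq int,
    [/\ word_prod n u = w, reduced n u
      & pairwise (fun i k => s_ n (i + 1) != s_ n k) u].

(* Since len w is finite, all but finitely many factors are the identity; the
   infinite product and sum of lengths are those of the first N factors. *)
Definition cd_factorizations (n : nat) (w : affperm n) :
    set (nat -> affperm n) :=
  [set f | (forall k, cyc_decreasing (f k)) /\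
    exists N : nat,
      [/\ forall k, (N <= k)%N -> f k = 1%g,
          w = (\prod_(k < N) f k)%g
        & len w = (\sum_(k < N) len (f k))%N]].

(* The infinite sum is taken coefficientwise: each monomial receives finitely
   many nonzero contributions, whereas the sum in fps would be infinite (and a
   \sum_(_ \in _) of infinite support is 0 by convention). *)
Definition F_ (n : nat) (w : affperm n) : fps :=
  fun a => \sum_(f \in cd_factorizations w) xpow (fun k => len (f k)) a.

(* A finite sum: all the atoms of z have the same length. *)
Definition F_FPF (n : nat) (z : affperm n) : fps :=
  \sum_(w \in atoms_FPF z) F_ w.

(* Main.v *)
Require Import Defs.
From mathcomp Require Import all_boot all_order all_algebra.
From mathcomp Require Import finmap zify ring lra.
From mathcomp Require Import boolp classical_sets functions cardinality fsbigop.
Set Implicit Arguments.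
Unset Strict Implicit.
Unset Printing Implicit Defensive.
Import Order.TTheory GRing.Theory Num.Theory.
Local Open Scope classical_set_scope.
Local Open Scope ring_scope.

(* For c : affperm n -> int put (T_r c)(v) = sum_j sgn(j - r) c(v t_{rj}), over the
   upper covers v t_{rj} of v in Bruhat order. With the operators A_i of the
   nilCoxeter algebra, T_r satisfies the twisted Leibniz rule
     T_r (A_i c)(v) = A_i (T_r c)(v) + ([v r = i] - [v r = i + 1]) c(v),
   and the correction terms of the sum of all cyclically decreasing elements of a
   given length cancel, so that T_r commutes with this sum. The coefficients of F_w
   arise from the indicator function of 1 by applying such sums, whence T_r F = 0,
   the transition formula of Lam and Shimozono.

   Now sum T_p F + T_q F over the atoms w of y. Let t = t_{ej} with e in {p, q}, and
   let t' = y t y. The terms with j congruent to y e cancel in pairs. If t is an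
   inversion of y, then w t t' is again an atom of y, and the covers w t = (w t t') t'
   of w and w t t' occur with opposite signs. Otherwise w t is an atom of
   z = t y t = t' y t', and conversely, for each atom v of z, exactly one of v t, v t'
   is an atom of y. The remaining negative terms thus give Pi_minus y p and the
   positive ones Pi_plus y q. *)

(** * Length and inversions *)

Arguments afun : simpl never.
Arguments affM : simpl never.
Arguments affV : simpl never.
Arguments aff1 : simpl never.
Arguments t_ : simpl never.
Arguments s_ : simpl never.

Declare Scope aff_scope.
Delimit Scope aff_scope with A.
Notation "u * v" := (affM u v) : aff_scope.
Notation "u ^-1" := (affV u) : aff_scope.
Notation "1" := (aff1 _) : aff_scope.

Section AffineCoxeter.
Variable m : nat.
Local Notation n := m.+2.
Implicit Types (u v w z : affperm n) (i j k a b x : int).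

Lemma affME u v x : (u * v)%A x = u (v x). Proof. by []. Qed.
Lemma aff1E x : (1%A : affperm n) x = x. Proof. by []. Qed.
Lemma affI u v w : (u * v)%A = (u * w)%A -> v = w.
Proof. by move=> E; rewrite -[v]aff1M -[w]aff1M -(affVM u) -!affMA E. Qed.
Lemma aff_inv1 : (1^-1)%A = 1%A :> affperm n.
Proof. by rewrite -[LHS]aff1M affMV. Qed.
Lemma aff_invK u : (u^-1^-1)%A = u.
Proof. by apply: (@affI (u^-1)%A); rewrite affMV affVM. Qed.
Lemma aff_invM u v : ((u * v)^-1)%A = (v^-1 * u^-1)%A.
Proof.
apply: (@affI (u * v)%A); rewrite affMV.
by rewrite -affMA [(v * _)%A]affMA affMV aff1M affMV.
Qed.
Lemma affVMA u v w : ((u * v)^-1 * w)%A = (v^-1 * (u^-1 * w))%A.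
Proof. by rewrite aff_invM -affMA. Qed.
Lemma affVK u : cancel u (u^-1)%A.
Proof. by move=> x; rewrite -affME affVM. Qed.
Lemma affKV u : cancel (u^-1)%A u.
Proof. by move=> x; rewrite -affME affMV. Qed.
Lemma aff_inj u : injective u. Proof. exact: can_inj (affVK u). Qed.

Lemma aff_shift u x k : u (x + k * n%:Z) = u x + k * n%:Z.
Proof. by apply: periodic_mul; case: (asboolP _ (afunP u)). Qed.

Lemma dvdz_ex (x : int) : (n%:Z %| x)%Z -> exists k : int, x = k * n%:Z.
Proof. by move/dvdzP=> [k ->]; exists k. Qed.

Lemma aff_dvd u x a : (n%:Z %| u x - u a)%Z = (n%:Z %| x - a)%Z.
Proof.
have H (v : affperm n) p q : (n%:Z %| p - q)%Z -> (n%:Z %| v p - v q)%Z.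
  move/dvdz_ex=> [k E]; have -> : p = q + k * n%:Z by rewrite -E; ring.
  by rewrite aff_shift [v q + _]addrC addrK dvdz_mull.
apply/idP/idP; last exact: H.
by move/(H (u^-1)%A); rewrite !affVK.
Qed.

Lemma tE a b x : t_ n a b x =
  if (n%:Z %| b - a)%Z then x else if (n%:Z %| x - a)%Z then x + (b - a)
  else if (n%:Z %| x - b)%Z then x - (b - a) else x.
Proof. by []. Qed.

Lemma dvdzBC x a : (n%:Z %| x - a)%Z = (n%:Z %| a - x)%Z.
Proof. by rewrite -opprB rpredN. Qed.

Lemma dvd_congr (x y c : int) : (n%:Z %| x - y)%Z ->
  (n%:Z %| x - c)%Z = (n%:Z %| y - c)%Z.
Proof.
by move=> H; rewrite -[RHS](rpredDl _ H); congr (_ %| _)%Z; ring.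
Qed.

Lemma t_sym a b : t_ n a b = t_ n b a.
Proof.
apply: affpermP => x; rewrite !tE [(n%:Z %| b - a)%Z]dvdzBC.
case: ifP => // ab; case: ifP => xa; case: ifP => xb //; try ring.
by move: ab; rewrite dvdzBC -(dvd_congr _ xb) xa.
Qed.

Lemma t_l a b : ~~ (n%:Z %| b - a)%Z -> t_ n a b a = b.
Proof. by move=> ab; rewrite tE (negPf ab) subrr dvdz0; ring. Qed.
Lemma t_r a b : ~~ (n%:Z %| b - a)%Z -> t_ n a b b = a.
Proof. by move=> ab; rewrite t_sym t_l // dvdzBC. Qed.
Lemma t_out a b x : ~~ (n%:Z %| x - a)%Z -> ~~ (n%:Z %| x - b)%Z ->
  t_ n a b x = x.
Proof. by move=> xa xb; rewrite tE (negPf xa) (negPf xb); case: ifP. Qed.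

Lemma t_dvd a b : (n%:Z %| b - a)%Z -> t_ n a b = 1%A.
Proof. by move=> ab; apply: affpermP => x; rewrite tE ab. Qed.

Lemma ttK a b : (t_ n a b * t_ n a b)%A = 1%A.
Proof.
case: (boolP (n%:Z %| b - a)%Z) => ab; first by rewrite t_dvd ?affM1.
apply: affpermP => x; rewrite affME aff1E.
have [/dvdz_ex [k E]|xa] := boolP (n%:Z %| x - a)%Z.
  have -> : x = a + k * n%:Z by rewrite -E; ring.
  by rewrite aff_shift t_l // aff_shift t_r.
have [/dvdz_ex [k E]|xb] := boolP (n%:Z %| x - b)%Z.
  have -> : x = b + k * n%:Z by rewrite -E; ring.
  by rewrite aff_shift t_r // aff_shift t_l.
by rewrite !t_out.
Qed.
Lemma tV a b : (t_ n a b)^-1%A = t_ n a b.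
Proof. by apply: (@affI (t_ n a b)); rewrite affMV ttK. Qed.

Lemma sV i : (s_ n i)^-1%A = s_ n i. Proof. exact: tV. Qed.

Lemma t_conj v a b : (v * t_ n a b)%A = (t_ n (v a) (v b) * v)%A.
Proof.
apply: affpermP => x; rewrite !affME.
case: (boolP (n%:Z %| b - a)%Z) => ab; first by rewrite !t_dvd ?aff_dvd.
have [/dvdz_ex [k E]|xa] := boolP (n%:Z %| x - a)%Z.
  have -> : x = a + k * n%:Z by rewrite -E; ring.
  by rewrite !aff_shift !t_l ?aff_dvd // aff_shift.
have [/dvdz_ex [k E]|xb] := boolP (n%:Z %| x - b)%Z.
  have -> : x = b + k * n%:Z by rewrite -E; ring.
  by rewrite !aff_shift !t_r ?aff_dvd // aff_shift.
by rewrite !t_out ?aff_dvd.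
Qed.

Lemma t_shift a b k : t_ n (a + k * n%:Z) (b + k * n%:Z) = t_ n a b.
Proof.
have S c : (n%:Z %| c - (c + k * n%:Z))%Z.
  by rewrite dvdzBC [c + _]addrC addrK dvdz_mull.
apply: affpermP => x; rewrite !tE.
have -> : b + k * n%:Z - (a + k * n%:Z) = b - a by ring.
by rewrite ![(n%:Z %| x - _)%Z]dvdzBC -!(dvd_congr _ (S _)).
Qed.

Lemma n_ndvd1 : ~~ (n%:Z %| 1)%Z.
Proof. by rewrite dvdz1; lia. Qed.

Lemma sE i x : s_ n i x =
  if (n%:Z %| x - i)%Z then x + 1 else if (n%:Z %| x - (i + 1))%Z then x - 1 else x.
Proof.
rewrite /s_ tE; have -> : i + 1 - i = 1 by ring.
by rewrite (negPf n_ndvd1).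
Qed.

Lemma s_bound i x : x - 1 <= s_ n i x <= x + 1.
Proof. by rewrite sE; case: ifP => _; [|case: ifP => _]; lia. Qed.

Lemma s_l i x : (n%:Z %| x - i)%Z -> s_ n i x = x + 1.
Proof. by rewrite sE => ->. Qed.
Lemma s_r i x : (n%:Z %| x - (i + 1))%Z -> s_ n i x = x - 1.
Proof.
by move=> H; rewrite sE H (dvd_congr _ H) addrAC subrr add0r (negPf n_ndvd1).
Qed.
Lemma s_out i x : ~~ (n%:Z %| x - i)%Z -> ~~ (n%:Z %| x - (i + 1))%Z ->
  s_ n i x = x.
Proof. by rewrite sE => /negPf -> /negPf ->. Qed.

Lemma s_per i j : (n%:Z %| i - j)%Z -> s_ n i = s_ n j.
Proof.
move/dvdz_ex=> [k E]; have -> : i = j + k * n%:Z by rewrite -E; ring.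
by rewrite /s_ -(t_shift j (j + 1) k); congr t_; ring.
Qed.

Lemma s_dvd i j : s_ n i = s_ n j -> (n%:Z %| i - j)%Z.
Proof.
move=> E; have : s_ n i i = s_ n j i by rewrite E.
rewrite s_l ?subrr ?dvdz0 // sE; case: ifP => // _.
by case: ifP => _; lia.
Qed.

Lemma near_id_inversion (f : int -> int) x y :
  (forall x, x - 1 <= f x <= x + 1) -> x < y -> f y < f x -> y = x + 1 /\ f x = y.
Proof. by move=> H; have := H x; have := H y; lia. Qed.

Lemma s_inversion i x y : x < y -> s_ n i y < s_ n i x ->
  y = x + 1 /\ (n%:Z %| x - i)%Z.
Proof.
move=> xy lt; have [-> E] := near_id_inversion (s_bound i) xy lt; split=> //.
move: E; rewrite sE; case: ifP => // _; case: ifP => _; lia.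
Qed.

Lemma sum_window (d : int -> int) (i : int) :
  (forall x k, d (x + k * n%:Z) = d x) ->
  \sum_(1 <= k < n.+1) d k%:Z = \sum_(1 <= k < n.+1) d (k%:Z + (i - 1)).
Proof.
move=> dn; apply/esym.
apply: (@sum_periodic n d (fun x => x + (i - 1))) => //.
  by exists (fun x => x - (i - 1)) => x; ring.
by move=> x; ring.
Qed.

(* Potential showing that sorting at descents terminates, so that the s_i generate. *)
Definition displacement w : int := \sum_(1 <= k < n.+1) (w k%:Z - k%:Z) ^+ 2.

Lemma displacement_ge0 w : 0 <= displacement w.
Proof. by apply: sumr_ge0 => k _; exact: sqr_ge0. Qed.

Lemma displacement_s w i : w (i + 1) < w i -> displacement (w * s_ n i)%A < displacement w.
Proof.
move=> lt; rewrite -subr_lt0 /displacement -sumrB.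
rewrite (sum_window i (d := fun x => ((w * s_ n i)%A x - x) ^+ 2 - (w x - x) ^+ 2)); last first.
  by move=> x k; rewrite !aff_shift; ring.
rewrite big_ltn // big_ltn // big_nat big1 ?addr0; last first.
  move=> k /andP[k1 k2]; rewrite affME s_out ?subrr //.
    have -> : k%:Z + (i - 1) - i = (k.-1)%:Z by lia.
    by rewrite dvdzE /=; apply/negP => /dvdn_leq; lia.
  have -> : k%:Z + (i - 1) - (i + 1) = (k.-2)%:Z by lia.
  by rewrite dvdzE /=; apply/negP => /dvdn_leq; lia.
have -> : 1%N%:Z + (i - 1) = i by lia.
have -> : 2%N%:Z + (i - 1) = i + 1 by lia.
rewrite !affME s_l ?subrr ?dvdz0 // s_r ?subrr ?dvdz0 // addrK; nra.
Qed.

Lemma increasing_aff1 w : (forall i, w i < w (i + 1)) -> w = 1%A.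
Proof.
move=> inc.
have step i (k : nat) : w i + k%:Z <= w (i + k%:Z).
  elim: k => [|k IH]; first by rewrite !addr0.
  have -> : i + k.+1%:Z = (i + k%:Z) + 1 by lia.
  by have := inc (i + k%:Z); lia.
have hN i (k : nat) : (k <= n)%N -> w (i + k%:Z) = w i + k%:Z.
  move=> kn; have := step (i + k%:Z) (n - k)%N; have := step i k.
  have -> : i + k%:Z + (n - k)%N%:Z = i + 1 * n%:Z by lia.
  by rewrite aff_shift; lia.
have [_ _ ws] := asboolP _ (afunP w).
have w0 : w 0 = 0.
  have : \sum_(1 <= k < n.+1) w k%:Z = \sum_(1 <= k < n.+1) (w 0 + k%:Z).
    rewrite big_nat [RHS]big_nat; apply: eq_bigr => k /andP[_ kn].
    by have := hN 0 k; rewrite add0r; apply.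
  rewrite ws big_split /= sumr_const_nat subn1 /=.
  by rewrite -[X in X = _]add0r => /addIr /esym/eqP; rewrite mulrn_eq0 => /eqP.
apply: affpermP => x; rewrite aff1E.
have nz : n%:Z != 0 by [].
have := hN 0 `|(x %% n%:Z)%Z|%N; rewrite w0 add0r gez0_abs ?modz_ge0 // => E.
rewrite (divz_eq x n%:Z) [_ * _ + _]addrC aff_shift E ?add0r //.
by have := ltz_mod x nz; have := modz_ge0 x nz; lia.
Qed.

Lemma word_prod_cons i (u : seq int) : word_prod n (i :: u) = (s_ n i * word_prod n u)%A.
Proof. by rewrite /word_prod big_cons. Qed.
Lemma word_prod_nil : word_prod n [::] = 1%A.
Proof. by rewrite /word_prod big_nil. Qed.
Lemma word_prod_cat (u v : seq int) :
  word_prod n (u ++ v) = (word_prod n u * word_prod n v)%A.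
Proof. by rewrite /word_prod big_cat. Qed.
Lemma word_prod_rev (u : seq int) : word_prod n (rev u) = (word_prod n u)^-1%A.
Proof.
elim: u => [|i u IH]; first by rewrite word_prod_nil aff_inv1.
by rewrite rev_cons -cats1 word_prod_cat word_prod_cons word_prod_cons word_prod_nil affM1 IH aff_invM tV.
Qed.

Lemma word_ex w : exists u : seq int, word_prod n u = w.
Proof.
move: {2}`|displacement w|%N (leqnn `|displacement w|%N) => d.
elim: d w => [|d IH] w hd.
  exists [::]; rewrite word_prod_nil; apply/esym/increasing_aff1 => i.
  have nlt : ~~ (w (i + 1) < w i).
    by apply/negP => /displacement_s; have := displacement_ge0 (w * s_ n i)%A; have := displacement_ge0 w; lia.
  have : w i != w (i + 1) by apply/eqP => /aff_inj; lia.
  lia.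
have [[i lt]|nex] := pselect (exists i, w (i + 1) < w i).
  have [|u Eu] := IH (w * s_ n i)%A.
    by have := displacement_s lt; have := displacement_ge0 (w * s_ n i)%A; have := displacement_ge0 w; lia.
  exists (u ++ [:: i]).
  by rewrite word_prod_cat word_prod_cons word_prod_nil affM1 Eu -affMA ttK affM1.
exists [::]; rewrite word_prod_nil; apply/esym/increasing_aff1 => i.
have nlt : ~~ (w (i + 1) < w i) by apply/negP => lt; apply: nex; exists i.
have : w i != w (i + 1) by apply/eqP => /aff_inj; lia.
lia.
Qed.

Lemma reduced_ex w : exists2 u : seq int, word_prod n u = w & reduced n u.
Proof.
have H : exists d, `[< exists2 u : seq int, word_prod n u = w & size u = d >].
  by have [u E] := word_ex w; exists (size u); apply/asboolP; exists u.
case: (ex_minnP H) => d /asboolP[u Eu su] dmin; exists u => // v Ev.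
by rewrite su; apply: dmin; apply/asboolP; exists v; rewrite ?Ev.
Qed.

Lemma len_reduced (u : seq int) : reduced n u -> len (word_prod n u) = size u.
Proof.
move=> ru; rewrite /len; set A := (X in xget _ X).
have Au : A (size u) by exists u.
case: xgetP => [x -> [v [Ev rv] <-]|/(_ _ Au)//].
by apply/eqP; rewrite eqn_leq rv // ru.
Qed.

Lemma len_word w : exists2 u : seq int, word_prod n u = w & size u = len w.
Proof. by have [u E ru] := reduced_ex w; exists u => //; rewrite -len_reduced // E. Qed.

Lemma len_le (u : seq int) : (len (word_prod n u) <= size u)%N.
Proof.
by have [v E rv] := reduced_ex (word_prod n u); rewrite -E len_reduced // rv.
Qed.

Lemma len1 : len (1%A : affperm n) = 0%N.
Proof. by have := len_le [::]; rewrite word_prod_nil leqn0 => /eqP. Qed.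
Lemma len0 w : len w = 0%N -> w = 1%A.
Proof.
by have [u <- <-] := len_word w; case: u => // _; rewrite word_prod_nil.
Qed.
Lemma lenM u v : (len (u * v)%A <= len u + len v)%N.
Proof.
have [a <- <-] := len_word u; have [b <- <-] := len_word v.
by rewrite -size_cat -word_prod_cat len_le.
Qed.
Lemma lenV u : len (u^-1)%A = len u.
Proof.
have H v : (len (v^-1)%A <= len v)%N.
  have [a <- <-] := len_word v.
  by rewrite -size_rev -word_prod_rev len_le.
by apply/eqP; rewrite eqn_leq H -{1}[u]aff_invK H.
Qed.
Lemma len_s i : (len (s_ n i) <= 1)%N.
Proof. by have := len_le [:: i]; rewrite word_prod_cons word_prod_nil affM1. Qed.

Lemma word_exchange (u : seq int) a b : a < b ->
  word_prod n u b < word_prod n u a ->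
  exists2 u' : seq int, word_prod n u' = (word_prod n u * t_ n a b)%A & (size u' < size u)%N.
Proof.
move=> ab; elim: u => [|i u IH]; first by rewrite word_prod_nil !aff1E; lia.
rewrite word_prod_cons; set w := word_prod n u in IH *.
have [lt|ge] := ltP (w b) (w a).
  have [u' Eu' su'] := IH lt.
  by move=> _; exists (i :: u'); rewrite ?word_prod_cons ?Eu' ?affMA.
rewrite !affME => lt.
have le : w a < w b by rewrite lt_neqAle ge andbT; apply/eqP => /aff_inj; lia.
have [E d] := s_inversion le lt.
exists u => //; rewrite -affMA t_conj E affMA -/w.
by rewrite -/(s_ n (w a)) (s_per d) ttK aff1M.
Qed.

Lemma len_inv w a b : a < b -> w b < w a -> (len (w * t_ n a b)%A < len w)%N.
Proof.
have [u <- <-] := len_word w => ab /(word_exchange ab)[u' <- lt].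
exact: leq_ltn_trans (len_le u') lt.
Qed.

Lemma len_ninv w a b : a < b -> ~~ (n%:Z %| b - a)%Z -> w a < w b ->
  (len w < len (w * t_ n a b)%A)%N.
Proof.
move=> ab d lt; have := @len_inv (w * t_ n a b)%A a b ab.
by rewrite -affMA ttK affM1; apply; rewrite !affME t_l // t_r.
Qed.

Lemma len_invE w a b : a < b -> ~~ (n%:Z %| b - a)%Z ->
  (len (w * t_ n a b)%A < len w)%N = (w b < w a).
Proof.
move=> ab d; have [lt|] := ltP (w b) (w a); first exact: len_inv.
rewrite le_eqVlt => /predU1P[/aff_inj E|lt]; first by lia.
by apply/negbTE; rewrite -leqNgt ltnW // len_ninv.
Qed.

Lemma s_ndvd i : ~~ (n%:Z %| i + 1 - i)%Z.
Proof. by rewrite addrC addKr n_ndvd1. Qed.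

Lemma len_ws w i : len (w * s_ n i)%A = (len w).+1 \/ len w = (len (w * s_ n i)%A).+1.
Proof.
have A : (len (w * s_ n i)%A <= len w + 1)%N.
  exact: leq_trans (lenM _ _) (leq_add _ (len_s i)).
have B : (len w <= len (w * s_ n i)%A + 1)%N.
  have := lenM (w * s_ n i)%A (s_ n i); rewrite -affMA ttK affM1.
  by have := len_s i; lia.
have C : len w != len (w * s_ n i)%A.
  have lti : i < i + 1 by lia.
  have := @len_invE w _ _ lti (s_ndvd i).
  have [lt|] := ltP (w (i + 1)) (w i); first by rewrite -/(s_ n i); lia.
  rewrite le_eqVlt => /predU1P[/aff_inj E|lt]; first by lia.
  by have := len_ninv lti (s_ndvd i) lt; rewrite -/(s_ n i); lia.
by lia.
Qed.

Lemma len_sw w i : len (s_ n i * w)%A = (len w).+1 \/ len w = (len (s_ n i * w)%A).+1.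
Proof.
have := len_ws (w^-1)%A i; rewrite lenV -[len (_ * _)%A]lenV aff_invM aff_invK tV.
by [].
Qed.

Lemma lifting v i a b : len (v * t_ n a b)%A = (len v).+1 ->
  (len v < len (s_ n i * v)%A)%N ->
  (len (s_ n i * (v * t_ n a b))%A < len (v * t_ n a b)%A)%N ->
  (s_ n i * (v * t_ n a b))%A = v.
Proof.
wlog ab : a b / a < b => [W|].
  have [lt|] := ltP a b; first exact: W.
  rewrite le_eqVlt => /predU1P[->|lt]; last by rewrite t_sym; exact: W.
  by rewrite t_dvd ?subrr ?dvdz0 // affM1; lia.
have [d|d] := boolP (n%:Z %| b - a)%Z; first by rewrite t_dvd // affM1; lia.
move=> upper_covers up down.
have lt : v a < v b.
  rewrite lt_neqAle; apply/andP; split; first by apply/eqP => /aff_inj; lia.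
  by rewrite leNgt -len_invE // upper_covers; lia.
have lt2 : s_ n i (v b) < s_ n i (v a).
  rewrite ltNge; apply/negP => le.
  have := @len_invE (s_ n i * (v * t_ n a b))%A _ _ ab d.
  rewrite -!affMA ttK affM1 !affME t_l // t_r // lt_neqAle le andbT.
  have -> : s_ n i (v a) != s_ n i (v b) by apply/eqP => /aff_inj /aff_inj; lia.
  by have := len_sw (v * t_ n a b)%A i; lia.
have [E di] := s_inversion lt lt2.
by rewrite t_conj E affMA -/(s_ n (v a)) (s_per di) ttK aff1M.
Qed.

Lemma finite_len (d : nat) : finite_set [set w : affperm n | (len w <= d)%N].
Proof.
elim: d => [|d IH].
  apply: (sub_finite_set (B := [set 1%A])); last exact: finite_set1.
  by move=> w /=; rewrite leqn0 => /eqP /len0.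
apply: (sub_finite_set (B := [set 1%A] `|`
   \bigcup_(i in [set: 'I_n]) ((fun w => (s_ n (i : nat)%:Z * w)%A) @` [set w : affperm n | (len w <= d)%N]))).
  move=> w /= le; have [u E su] := len_word w; case: u E su => [|i u].
    by rewrite word_prod_nil => <- _; left.
  rewrite word_prod_cons /= => E su; right.
  have lti : (`|(i %% n%:Z)%Z| < n)%N.
    by rewrite -ltz_nat gez0_abs ?modz_ge0 // ltz_mod.
  exists (Ordinal lti) => //; exists (word_prod n u) => /=.
    by have := len_le u; lia.
  rewrite -E; congr (_ * _)%A; apply: s_per.
  by rewrite gez0_abs ?modz_ge0 // {2}(divz_eq i n%:Z) opprD addrCA subrr addr0 rpredN dvdz_mull.
rewrite finite_setU; split; first exact: finite_set1.
apply: bigcup_finite; first exact: finite_finset.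
by move=> i _; apply: finite_image.
Qed.

End AffineCoxeter.

(** * The Chevalley operators and the nilCoxeter algebra *)

Section Chevalley.
Variable m : nat.
Local Notation n := m.+2.
Implicit Types (u v w z : affperm n) (i j k a b x r : int) (c : affperm n -> int).

Definition upper_covers v r : set int := [set j | len (v * t_ n r j)%A = (len v).+1].

Lemma upper_covers_ndvd v r j : upper_covers v r j -> ~~ (n%:Z %| j - r)%Z.
Proof. by apply: contraPN => d; rewrite /upper_covers /= t_dvd // affM1; lia. Qed.

Lemma finite_upper_covers v r : finite_set (upper_covers v r).
Proof.
apply: (sub_finite_set (B := (fun w : affperm n => (v^-1)%A (w r)) @` [set w | (len w <= (len v).+1)%N])).
  move=> j Cj; exists (v * t_ n r j)%A; first by rewrite /= Cj.
  by rewrite affME t_l ?affVK //; exact: upper_covers_ndvd Cj.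
exact/finite_image/finite_len.
Qed.

(* T_r above; an index j congruent to r gives t_{rj} = 1, hence no cover. *)
Definition chevalley r c v : int :=
  \sum_(j \in upper_covers v r) Num.sg (j - r) * c (v * t_ n r j)%A.

(* Action of the nilCoxeter generator A_i on coefficient functions. *)
Definition Aop i c v : int :=
  if (len (s_ n i * v)%A < len v)%N then c (s_ n i * v)%A else 0.

Definition chi i x : int := (n%:Z %| x - i)%Z%:R - (n%:Z %| x - (i + 1))%Z%:R.

Lemma sum_exceptional r i c v :
  \sum_(j \in [set j | (s_ n i * (v * t_ n r j))%A = v])
     Num.sg (j - r) * c (s_ n i * (v * t_ n r j))%A =
  (-1) ^+ (len (s_ n i * v)%A < len v)%N * chi i (v r) * c v.
Proof.
set E := (X in \sum_(j \in X) _).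
have [fx|nfx] := eqVneq (s_ n i (v r)) (v r).
  have -> : chi i (v r) = 0.
    rewrite /chi; have := fx; rewrite sE; case: ifP => // _; first by lia.
    by case: ifP => // _; lia.
  rewrite mulr0 mul0r fsbig1 // => j /= Ej; exfalso.
  have : (s_ n i * (v * t_ n r j))%A r = v r by rewrite Ej.
  rewrite !affME; have [d|d] := boolP (n%:Z %| j - r)%Z.
    move: Ej; rewrite /E /= t_dvd // affM1 => /(congr1 (@len _)).
    by have := len_sw v i; lia.
  rewrite t_l // -[in RHS]fx => /aff_inj/aff_inj jr; by rewrite jr subrr dvdz0 in d.
pose j0 := (v^-1)%A (s_ n i (v r)).
have vj0 : v j0 = s_ n i (v r) by rewrite affKV.
have ssK x : s_ n i (s_ n i x) = x by rewrite -affME ttK.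
have vne : ~~ (n%:Z %| j0 - r)%Z.
  rewrite -(aff_dvd v) vj0; move: nfx; rewrite sE; case: ifP => _.
    by rewrite addrAC subrr add0r n_ndvd1.
  by case: ifP; rewrite ?eqxx // addrAC subrr add0r rpredN n_ndvd1.
have sv : (s_ n i * v)%A = (v * t_ n r j0)%A.
  rewrite t_conj vj0; congr (_ * _)%A; move: nfx; rewrite sE.
  case: ifP => [/s_per <- //|_]; case: ifP => [d _|]; last by rewrite eqxx.
  rewrite t_sym; have d' : (n%:Z %| v r - 1 - i)%Z by rewrite -addrA -opprD [1 + i]addrC.
  by rewrite -(s_per d') /s_ subrK.
have -> : E = [set j0].
  apply/seteqP; split=> j /=; last by move=> ->; rewrite /E /= -sv affMA ttK aff1M.
  move=> Ej; have : (s_ n i * (v * t_ n r j))%A r = v r by rewrite Ej.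
  rewrite !affME; have [d|d] := boolP (n%:Z %| j - r)%Z.
    by rewrite t_dvd // aff1E => /eqP; rewrite (negPf nfx).
  by rewrite t_l // => H; rewrite -[j](affVK v) -(ssK (v j)) H.
rewrite fsbig_set1 -sv affMA ttK aff1M; congr (_ * _).
rewrite sv; have : v j0 = v r + 1 /\ chi i (v r) = 1 \/ v j0 = v r - 1 /\ chi i (v r) = -1.
  rewrite vj0 /chi; move: nfx; rewrite sE; case: ifP => [d _|d].
    by left; rewrite (dvd_congr _ d) opprD addNKr rpredN (negPf (n_ndvd1 _)).
  by case: ifP => [d2 _|]; [right|rewrite eqxx].
have [lt|ge] := ltP r j0.
  rewrite len_invE // gtr0_sg ?subr_gt0 //.
  by case=> -[-> ->]; [have -> : v r + 1 < v r = false by lia|have -> : v r - 1 < v r by lia].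
have lt : j0 < r by rewrite lt_neqAle ge andbT; apply: contraNneq vne => ->; rewrite subrr dvdz0.
rewrite t_sym len_invE // 1?dvdzBC // ltr0_sg ?subr_lt0 //.
by case=> -[-> ->]; [have -> : v r < v r + 1 by lia|have -> : v r < v r - 1 = false by lia].
Qed.

(* The correction term comes from the index j with s_i v t_{rj} = v; by the lifting
   property the other covers of v and of s_i v correspond. *)
Lemma chevalley_Aop r i c v : chevalley r (Aop i c) v = Aop i (chevalley r c) v + chi i (v r) * c v.
Proof.
pose G j := Num.sg (j - r) * c (s_ n i * (v * t_ n r j))%A.
pose E := [set j | (s_ n i * (v * t_ n r j))%A = v].
pose D := [set j | (len (s_ n i * (v * t_ n r j))%A < len (v * t_ n r j)%A)%N].
have -> : chevalley r (Aop i c) v = \sum_(j \in upper_covers v r `&` D) G j.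
  rewrite /chevalley -(@fsbig_widen _ _ _ _ (upper_covers v r `&` D)).
  - by apply: eq_fsbigr => j; rewrite inE => -[_ Dj]; rewrite /Aop Dj.
  - by move=> j [].
  - move=> j [Cj /= nD]; rewrite /Aop ifF ?mulr0 //.
    by apply/negP => Dj; apply: nD.
have HE := sum_exceptional r i c v; rewrite -/E in HE.
rewrite /Aop; case: ifP HE => [down|up]; last first.
  have {}up : (len v < len (s_ n i * v)%A)%N by have := len_sw v i; lia.
  rewrite expr0 mul1r add0r => <-; apply: eq_fsbigl; apply/seteqP; split=> j /=.
    by move=> [Cj Dj]; apply: lifting.
  move=> Ej; have E' : (v * t_ n r j)%A = (s_ n i * v)%A by rewrite -[in RHS]Ej affMA ttK aff1M.
  by rewrite /upper_covers /D /= E' affMA ttK aff1M; have := len_sw v i; lia.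
rewrite expr1 mulN1r mulNr => HE.
rewrite /chevalley [in RHS](fsbigID E); last exact: finite_upper_covers.
set S1 := (X in _ = X + _ + _); have -> : S1 = - (chi i (v r) * c v).
  rewrite /S1 -HE; under eq_fsbigr do rewrite -affMA.
  apply: eq_fsbigl; apply/seteqP; split=> j /=; first by case.
  move=> Ej; split=> //; rewrite /upper_covers /= -affMA Ej.
  by have := len_sw v i; lia.
rewrite addrAC addNr add0r; under [RHS]eq_fsbigr do rewrite -affMA.
apply: eq_fsbigl; apply/seteqP; split=> j /= [H1 H2].
  have := len_sw v i; have := len_sw (v * t_ n r j)%A i; move: H1 H2.
  rewrite /upper_covers /D /= -affMA => H1 H2 H3 H4; split; first by lia.
  rewrite /E /= => H; have H' : (v * t_ n r j)%A = (s_ n i * v)%A by rewrite -[in RHS]H affMA ttK aff1M.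
  by move: H1; rewrite H'; lia.
move: H1; rewrite /upper_covers /= -affMA => H1.
have := len_sw v i; have := len_sw (v * t_ n r j)%A i.
rewrite /upper_covers /D /= => H3 H4; suff: (len (v * t_ n r j)%A = (len v).+1) by split; lia.
case: H3 => H3; last by lia.
exfalso; apply: H2; rewrite /E /=.
have := @lifting _ (v * t_ n r j)%A i r j.
rewrite -!affMA ttK affM1 => L.
by have <- : (s_ n i * v)%A = (v * t_ n r j)%A; [apply: L; lia|rewrite affMA ttK aff1M].
Qed.

Definition Aw (u : seq int) c : affperm n -> int := foldr Aop c u.

Lemma AwE (u : seq int) c v : Aw u c v =
  if (len ((word_prod n u)^-1 * v)%A + size u == len v)%N
  then c ((word_prod n u)^-1 * v)%A else 0.
Proof.
elim: u v => [|i u IH] v /=.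
  by rewrite word_prod_nil aff_inv1 aff1M addn0 eqxx.
rewrite /Aop word_prod_cons affVMA sV; case: ifP => lt.
  by rewrite IH; have := len_sw v i; case: ifP; case: ifP => //; lia.
case: ifP => // /eqP E; exfalso.
have := lenM (word_prod n u) ((word_prod n u)^-1 * (s_ n i * v))%A.
by rewrite affMA affMV aff1M; have := len_le m u; have := len_sw v i; lia.
Qed.

Lemma chevalley_Aw r (u : seq int) c v : uniq u -> chevalley r (Aw u c) v = Aw u (chevalley r c) v +
  \sum_(i <- u) chi i ((word_prod n (take (index i u) u))^-1 (v r))%A *
     Aw (rem i u) c v.
Proof.
elim: u v => [|i u IH] v /=; first by rewrite big_nil addr0.
move=> /andP[iu uu]; rewrite chevalley_Aop big_cons /= eqxx take0 word_prod_nil aff_inv1 aff1E.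
rewrite [RHS]addrCA [LHS]addrC; congr (_ + _).
rewrite {1}/Aop; case: ifP => lt; last first.
  rewrite {1}/Aop lt add0r big_seq big1 // => j ju.
  case: eqVneq => [ij|_]; first by rewrite ij ju in iu.
  by rewrite /= /Aop lt mulr0.
rewrite IH // {1}/Aop lt; congr (_ + _).
rewrite big_seq [RHS]big_seq; apply: eq_bigr => j ju.
case: eqVneq => [ij|_]; first by rewrite ij ju in iu.
by rewrite /= word_prod_cons aff_invM sV affME affME /Aop lt.
Qed.

Lemma chevalley_sum (I : Type) (s : seq I) (P : pred I) r (g : I -> affperm n -> int) v :
  chevalley r (fun w => \sum_(J <- s | P J) g J w) v = \sum_(J <- s | P J) chevalley r (g J) v.
Proof.
rewrite /chevalley fsbig_finite; last exact: finite_upper_covers.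
under eq_bigr do rewrite mulr_sumr.
rewrite exchange_big; apply: eq_bigr => J _.
by rewrite fsbig_finite //; exact: finite_upper_covers.
Qed.
End Chevalley.

(** * Cyclically decreasing elements *)

Section CyclicallyDecreasing.
Variable m : nat.
Local Notation n := m.+2.
Implicit Types (u v z : affperm n) (a x r : int) (c : affperm n -> int).
Implicit Types (i j k : 'I_n) (w : seq 'I_n) (J : {set 'I_n}).

Definition intw w : seq int := [seq (i : nat)%:Z | i <- w].
Definition wprod w : affperm n := word_prod n (intw w).

Lemma wprod_nil : wprod [::] = 1%A. Proof. exact: word_prod_nil. Qed.
Lemma wprod_cons i w : wprod (i :: w) = (s_ n (i : nat)%:Z * wprod w)%A.
Proof. exact: word_prod_cons. Qed.
Lemma wprod_cat w1 w2 : wprod (w1 ++ w2) = (wprod w1 * wprod w2)%A.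
Proof. by rewrite /wprod /intw map_cat word_prod_cat. Qed.
Lemma wprod_rcons w i : wprod (rcons w i) = (wprod w * s_ n (i : nat)%:Z)%A.
Proof. by rewrite -cats1 wprod_cat wprod_cons wprod_nil affM1. Qed.
Lemma wprod_rev w : wprod (rev w) = ((wprod w)^-1)%A.
Proof. by rewrite /wprod /intw map_rev word_prod_rev. Qed.

Lemma ord_dvd i k : (n%:Z %| (i : nat)%:Z - (k : nat)%:Z)%Z = (i == k).
Proof.
apply/idP/eqP => [|->]; last by rewrite subrr dvdz0.
apply: contraTeq => ik; have {}ik : (i : nat) != k by [].
by rewrite dvdzE gtnNdvd //; have := ltn_ord i; have := ltn_ord k; lia.
Qed.

Definition residue x : 'I_n := inord `|(x %% n%:Z)%Z|%N.
Lemma residueP x : (n%:Z %| x - (residue x : nat)%:Z)%Z.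
Proof.
have nz : n%:Z != 0 by [].
rewrite inordK; last by rewrite -ltz_nat gez0_abs ?modz_ge0 // ltz_mod.
by rewrite gez0_abs ?modz_ge0 // {1}(divz_eq x n%:Z) addrK dvdz_mull.
Qed.
Lemma residue_eq x i : (residue x == i) = (n%:Z %| x - (i : nat)%:Z)%Z.
Proof. by rewrite -ord_dvd -(dvd_congr _ (residueP x)). Qed.

Lemma residue_congr x y : (n%:Z %| x - y)%Z -> residue x = residue y.
Proof. by move=> d; apply/eqP; rewrite residue_eq (dvd_congr _ d) residueP. Qed.
Lemma residue_val i : residue (i : nat)%:Z = i.
Proof. by apply/eqP; rewrite residue_eq subrr dvdz0. Qed.

Definition succ_ord i k := (n%:Z %| (k : nat)%:Z - ((i : nat)%:Z + 1))%Z.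
Definition is_cd_word w := uniq w && pairwise (fun i k => ~~ succ_ord i k) w.

Lemma s_comm i k : ~~ succ_ord i k -> ~~ succ_ord k i ->
  (s_ n (i : nat)%:Z * s_ n (k : nat)%:Z)%A = (s_ n (k : nat)%:Z * s_ n (i : nat)%:Z)%A.
Proof.
have [->//|ik] := eqVneq i k.
move=> ik1 ki1; rewrite {2 3}/s_ t_conj !s_out //.
- by rewrite dvdzBC.
- by rewrite opprD addrACA subrr addr0 dvdzBC ord_dvd.
- by rewrite dvdzBC ord_dvd.
Qed.

Lemma wprod_comm i w : all (fun k => ~~ succ_ord i k && ~~ succ_ord k i) w ->
  (wprod w * s_ n (i : nat)%:Z)%A = (s_ n (i : nat)%:Z * wprod w)%A.
Proof.
elim: w => [|k w IH] /=; first by rewrite wprod_nil affM1 aff1M.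
move=> /andP[/andP[ik ki] /IH E].
by rewrite wprod_cons -affMA E !affMA s_comm.
Qed.

Lemma is_cd_word_cons i w : is_cd_word (i :: w) =
  [&& i \notin w, all (fun k => ~~ succ_ord i k) w & is_cd_word w].
Proof. by rewrite /is_cd_word /=; do !case: (_ \notin _) (all _ _) (uniq _) => [] [] [] //=. Qed.

Lemma is_cd_word_split w1 i w2 : is_cd_word (w1 ++ i :: w2) ->
  [/\ i \notin w1, i \notin w2,
      all (fun k => ~~ succ_ord k i) w1, all (fun k => ~~ succ_ord i k) w2
    & is_cd_word (w1 ++ w2)].
Proof.
rewrite /is_cd_word cat_uniq !pairwise_cat allrel_consr /= cat_uniq.
move=> /andP[/and3P[u1 H /andP[i2 u2]] /and3P[/andP[H1 H2] p1 /andP[p2 p3]]].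
move: H; rewrite negb_or => /andP[i1 h12].
by split=> //; rewrite u1 h12 u2 H2 p1 p3.
Qed.

Lemma cd_wprod_unique w w' : is_cd_word w -> is_cd_word w' -> w =i w' -> wprod w = wprod w'.
Proof.
elim: w w' => [|i w IH] w' cw cw' E.
  by case: w' cw' E => // i w' _ /(_ i); rewrite !inE eqxx.
have iw' : i \in w' by rewrite -E mem_head.
case/splitPr: w' / iw' cw' E => [w1 w2] cw' E.
have [i1 i2 h1 h2 c12] := is_cd_word_split cw'.
move: cw; rewrite is_cd_word_cons => /and3P[iw /allP aw cw].
rewrite wprod_cons (IH (w1 ++ w2)) //; last first.
  move=> k; have := E k; rewrite !inE !mem_cat inE.
  have [->|] //= := eqVneq k i.
  by rewrite (negPf iw) (negPf i1) (negPf i2).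
rewrite !wprod_cat wprod_cons !affMA wprod_comm //.
apply/allP => k k1; rewrite (allP h1) // andbT aw //.
have := E k; rewrite !inE mem_cat k1 /=; have [ki|//] := eqVneq k i.
by rewrite -ki k1 in i1.
Qed.

Lemma wprod_fix w x : (forall k, k \in w -> ~~ (n%:Z %| x - (k : nat)%:Z)%Z &&
   ~~ (n%:Z %| x - ((k : nat)%:Z + 1))%Z) -> wprod w x = x.
Proof.
elim: w => [|k w IH] H; first by rewrite wprod_nil aff1E.
rewrite wprod_cons affME IH; last by move=> j jw; apply: H; rewrite inE jw orbT.
by have /andP[h1 h2] := H k (mem_head _ _); rewrite s_out.
Qed.

Lemma wprod_ge w x : uniq w -> (forall k, k \in w -> ~~ (n%:Z %| x - 1 - (k : nat)%:Z)%Z) ->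
  x <= wprod w x.
Proof.
elim/last_ind: w x => [|w k IH] x; first by rewrite wprod_nil aff1E.
rewrite rcons_uniq => /andP[kw uw] H; rewrite wprod_rcons affME.
have Hk := H k; rewrite mem_rcons mem_head in Hk.
have [d|d] := boolP (n%:Z %| x - (k : nat)%:Z)%Z.
  rewrite s_l //; apply: le_trans (IH (x + 1) uw _); first by lia.
  move=> j jw; rewrite addrK (dvd_congr _ d) ord_dvd.
  by apply: contraNneq kw => ->.
rewrite s_out //; last by rewrite [_ + 1]addrC opprD addrA Hk.
by apply: IH => // j jw; apply: H; rewrite mem_rcons inE jw orbT.
Qed.

Lemma wprod_le w x : uniq w -> (forall k, k \in w -> ~~ (n%:Z %| x - (k : nat)%:Z)%Z) ->
  wprod w x <= x.
Proof.
elim/last_ind: w x => [|w k IH] x; first by rewrite wprod_nil aff1E.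
rewrite rcons_uniq => /andP[kw uw] H; rewrite wprod_rcons affME.
have Hk := H k; rewrite mem_rcons mem_head in Hk.
have [d|d] := boolP (n%:Z %| x - ((k : nat)%:Z + 1))%Z.
  rewrite s_r //; apply: le_trans (IH (x - 1) uw _) _; last by lia.
  move=> j jw; have d' : (n%:Z %| x - 1 - (k : nat)%:Z)%Z.
    by move: d; rewrite [_ + 1]addrC opprD addrA.
  by rewrite (dvd_congr _ d') ord_dvd; apply: contraNneq kw => ->.
rewrite s_out ?Hk //.
by apply: IH => // j jw; apply: H; rewrite mem_rcons inE jw orbT.
Qed.

Lemma cd_wprod_descent w i : is_cd_word w -> i \in w -> wprod w ((i : nat)%:Z + 1) = (i : nat)%:Z.
Proof.
move=> cw iw; case/splitPr: w / iw cw => [w1 w2] cw.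
have [i1 i2 h1 h2 _] := is_cd_word_split cw.
rewrite wprod_cat wprod_cons !affME (wprod_fix (w := w2)); last first.
  move=> k kw; rewrite dvdzBC -/(succ_ord _ _) (allP h2) //= opprD addrACA subrr addr0 ord_dvd.
  by apply: contraNneq i2 => ->.
rewrite s_r ?subrr ?dvdz0 // addrK wprod_fix // => k kw.
by rewrite ord_dvd -/(succ_ord _ _) (allP h1) // andbT; apply: contraNneq i1 => ->.
Qed.

Lemma len_cd_wprod w : is_cd_word w -> len (wprod w) = size w.
Proof.
elim: w => [|i w IH]; first by rewrite wprod_nil len1.
rewrite is_cd_word_cons => /and3P[iw /allP aw cw]; rewrite wprod_cons /= -IH //.
have [//|E] := len_sw (wprod w) (i : nat)%:Z.
have lti : (i : nat)%:Z < (i : nat)%:Z + 1 by lia.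
have := @len_invE _ ((wprod w)^-1)%A _ _ lti (s_ndvd _ _).
rewrite -/(s_ n _) -lenV aff_invM aff_invK sV lenV {1}E ltnS leqnn.
rewrite -wprod_rev [X in _ = (X < _)]wprod_fix; last first.
  move=> k; rewrite mem_rev => kw; rewrite dvdzBC -/(succ_ord _ _) aw //= opprD addrACA subrr addr0 ord_dvd.
  by apply: contraNneq iw => ->.
have : wprod (rev w) (i : nat)%:Z <= (i : nat)%:Z.
  apply: wprod_le; first by rewrite rev_uniq; case/andP: cw.
  by move=> k; rewrite mem_rev ord_dvd => kw; apply: contraNneq iw => ->.
lia.
Qed.

Lemma cd_reduced w : is_cd_word w -> reduced n (intw w).
Proof.
move=> cw v E; have := len_le m v; rewrite E -/(wprod w) len_cd_wprod //.
by rewrite size_map.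
Qed.

Lemma proper_succ J : J != finset.set0 -> J != [set: 'I_n]%SET ->
  exists2 i, i \in J & forall k, k \in J -> ~~ succ_ord i k.
Proof.
move=> /finset.set0Pn[i0 J0] JT; apply: contrapT => nex.
have H i : i \in J -> residue ((i : nat)%:Z + 1) \in J.
  move=> iJ; apply: contrapT => nJ; apply: nex; exists i => // k kJ.
  by apply/negP => d; apply: nJ; have /eqP <- : k == residue ((i : nat)%:Z + 1)
    by rewrite eq_sym residue_eq dvdzBC.
have {}H (d : nat) : residue ((i0 : nat)%:Z + d%:Z) \in J.
  elim: d => [|d IH]; first by rewrite addr0 residue_val.
  have := H _ IH; congr (_ \in J); apply: residue_congr.
  have -> : (i0 : nat)%:Z + d.+1%:Z = (i0 : nat)%:Z + d%:Z + 1 by lia.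
  by rewrite opprD addrACA subrr addr0 dvdzBC residueP.
apply: (negP JT); apply/eqP/finset.setP => k; rewrite [RHS]inE.
have := H (k + n - i0)%N; congr (_ \in J); apply/eqP; rewrite residue_eq.
have -> : (i0 : nat)%:Z + (k + n - i0)%N%:Z - (k : nat)%:Z = n%:Z.
  by have := ltn_ord i0; lia.
exact: dvdzz.
Qed.

Definition letters_of J w := is_cd_word w /\ w =i J.
Definition cd_word J : seq 'I_n := xget [::] [set w | letters_of J w].

Lemma cd_wordP J : J != [set: 'I_n]%SET -> letters_of J (cd_word J).
Proof.
move=> JT; rewrite /cd_word; case: xgetP => [w -> //|nex]; exfalso.
suff [w cw] : exists w, letters_of J w by exact: nex w cw.
move: {2}#|J| (leqnn #|J|) => d {nex}; elim: d J JT => [|d IH] J JT dJ.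
  by exists [::]; split=> // i; rewrite (cards0_eq (A := J)) ?inE //; lia.
have [J0|J0] := eqVneq J finset.set0; first by exists [::]; split=> // i; rewrite J0 !inE.
have [i iJ iS] := proper_succ J0 JT.
have [||w [cw wJ]] := IH (J :\ i)%SET.
- by apply/eqP => E; have := finset.in_setT i; rewrite -E !inE eqxx.
- by have := cardsD1 i J; rewrite iJ; lia.
exists (i :: w); split.
  rewrite is_cd_word_cons cw wJ !inE eqxx /= andbT; apply/allP => k.
  by rewrite wJ !inE => /andP[_]; exact: iS.
by move=> k; rewrite inE wJ !inE; case: eqVneq => [->|].
Qed.

Lemma card_letters J w : letters_of J w -> size w = #|J|.
Proof.
by move=> [/andP[uw _] wJ]; rewrite -(card_uniqP uw); apply: eq_card.
Qed.

Lemma cd_missing_letter w : is_cd_word w -> exists i, i \notin w.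
Proof.
case: w => [_|i w]; first by exists ord0.
rewrite is_cd_word_cons => /and3P[iw /allP aw _].
pose k := residue ((i : nat)%:Z + 1); exists k.
have ik : succ_ord i k by rewrite /succ_ord dvdzBC residueP.
rewrite inE negb_or; apply/andP; split; last by apply/negP => /aw; rewrite ik.
apply: contraTneq ik => ->; rewrite /succ_ord opprD addNKr.
by rewrite rpredN n_ndvd1.
Qed.

Lemma nonuniq_shorten w : pairwise (fun i k => ~~ succ_ord i k) w -> ~~ uniq w ->
  exists2 v : seq int, word_prod n v = wprod w & (size v < size w)%N.
Proof.
elim: w => [//|i w IH] /= /andP[aw pw]; rewrite negb_and negbK.
have [iw _|iw /= nu] := boolP (i \in w); last first.
  by have [v Ev sv] := IH pw nu; exists ((i : nat)%:Z :: v); rewrite // word_prod_cons wprod_cons Ev.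
case/splitPr: w / iw IH aw pw => [w1 w2] _; rewrite all_cat pairwise_cat allrel_consr.
move=> /andP[h1 _] /and3P[/andP[h2 _] _ _].
exists (intw (w1 ++ w2)); last by rewrite size_map /= !size_cat /=; lia.
rewrite -/(wprod _) wprod_cons !wprod_cat wprod_cons !affMA -wprod_comm.
  by rewrite -[(wprod w1 * _ * _)%A]affMA ttK affM1.
by apply/allP => k kw; rewrite (allP h1) // (allP h2).
Qed.

Lemma cyc_decreasing_cd_word J : J != [set: 'I_n]%SET -> cyc_decreasing (wprod (cd_word J)).
Proof.
move=> /cd_wordP[cw _]; exists (intw (cd_word J)); split=> //; first exact: cd_reduced.
rewrite pairwise_map; case/andP: cw => _; apply: sub_pairwise => i k /=.
by apply: contraNneq => /s_dvd; rewrite /succ_ord dvdzBC.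
Qed.

Lemma len_cd_word J : J != [set: 'I_n]%SET -> len (wprod (cd_word J)) = #|J|.
Proof. by move=> /cd_wordP L; rewrite len_cd_wprod ?(card_letters L) //; case: L. Qed.

Lemma cyc_decreasingP u : cyc_decreasing u ->
  exists2 J, J != [set: 'I_n]%SET & u = wprod (cd_word J).
Proof.
move=> [v [<- rv pv]]; pose w := map residue v.
have Ew : wprod w = word_prod n v.
  rewrite /w; elim: (v) => [|a l IH] /=; first by rewrite wprod_nil word_prod_nil.
  by rewrite wprod_cons word_prod_cons IH -(s_per (residueP a)).
have pw : pairwise (fun i k => ~~ succ_ord i k) w.
  rewrite pairwise_map; apply: sub_pairwise pv => a b /=.
  apply: contraNN => d; apply/eqP/s_per.
  have -> : a + 1 - b = (a - (residue a : nat)%:Z) - (b - (residue b : nat)%:Z)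
    - ((residue b : nat)%:Z - ((residue a : nat)%:Z + 1)) by ring.
  by apply: rpredB; [apply: rpredB; exact: residueP|exact: d].
have cw : is_cd_word w.
  rewrite /is_cd_word pw andbT; apply: contrapT => /negP nu.
  have [v' E' s'] := nonuniq_shorten pw nu.
  by have := rv v'; rewrite E' Ew => /(_ erefl); rewrite size_map in s'; lia.
pose J := [set i in w]%SET.
have JT : J != [set: 'I_n]%SET.
  have [i iw] := cd_missing_letter cw; apply: contraNneq iw => JT.
  by have := finset.in_setT i; rewrite -JT inE.
exists J => //; rewrite -Ew; have [cJ eJ] := cd_wordP JT.
by apply: cd_wprod_unique => // i; rewrite eJ inE.
Qed.

Lemma wprod_cd_word_inj J J' : J != [set: 'I_n]%SET -> J' != [set: 'I_n]%SET ->
  wprod (cd_word J) = wprod (cd_word J') -> J = J'.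
Proof.
have H K i : K != [set: 'I_n]%SET -> (i \in K) = (wprod (cd_word K) ((i : nat)%:Z + 1) == (i : nat)%:Z).
  move=> /cd_wordP[cw <-]; have [iw|iw] := boolP (i \in cd_word K); first by rewrite cd_wprod_descent // eqxx.
  have : (i : nat)%:Z + 1 <= wprod (cd_word K) ((i : nat)%:Z + 1).
    apply: wprod_ge; first by case/andP: cw.
    by move=> k kw; rewrite addrK ord_dvd; apply: contraNneq iw => ->.
  by lia.
by move=> JT JT' E; apply/finset.setP => i; rewrite !H // E.
Qed.

End CyclicallyDecreasing.

(** * Transitions for affine Stanley symmetric functions *)

Section FominStanley.
Variable m : nat.
Local Notation n := m.+2.
Implicit Types (u v z : affperm n) (a x r : int) (c : affperm n -> int).
Implicit Types (i j k : 'I_n) (w : seq 'I_n) (J : {set 'I_n}).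

Lemma index_intw i w : index (i : nat)%:Z (intw w) = index i w.
Proof. by apply: index_map => x y [] /val_inj. Qed.

Lemma rem_intw i w : rem (i : nat)%:Z (intw w) = intw (rem i w).
Proof.
elim: w => [//|k w IH] /=; rewrite IH.
have -> : ((k : nat)%:Z == (i : nat)%:Z) = (k == i) by [].
by case: ifP.
Qed.

Lemma rem_mid i w1 w2 : i \notin w1 -> rem i (w1 ++ i :: w2) = w1 ++ w2.
Proof.
elim: w1 => [|k w1 IH] /=; first by rewrite eqxx.
by rewrite inE negb_or eq_sym => /andP[/negPf -> /IH ->].
Qed.

Lemma chi_pre i w x : is_cd_word w -> i \in w ->
  chi m (i : nat)%:Z ((wprod (take (index i w) w))^-1 x)%A =
  (residue m x == i)%:R - (residue m x == residue m (wprod (rem i w) ((i : nat)%:Z + 1)))%:R.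
Proof.
move=> cw iw; case/splitPr: w / iw cw => [w1 w2] cw.
have [i1 i2 h1 h2 _] := is_cd_word_split cw.
rewrite index_cat (negPf i1) /= eqxx addn0 take_size_cat // rem_mid //.
rewrite wprod_cat affME (wprod_fix (w := w2)); last first.
  move=> k kw; rewrite dvdzBC -/(succ_ord _ _) (allP h2) //= opprD addrACA subrr addr0 ord_dvd.
  by apply: contraNneq i2 => ->.
rewrite /chi -(aff_dvd (wprod w1) _ (i : nat)%:Z).
rewrite -(aff_dvd (wprod w1) _ ((i : nat)%:Z + 1)) affKV; congr (_%:R - _%:R).
  rewrite wprod_fix ?residue_eq // => k kw.
  by rewrite ord_dvd -/(succ_ord _ _) (allP h1) // andbT; apply: contraNneq i1 => ->.
set y := wprod w1 _.
by rewrite dvdzBC (dvd_congr _ (residueP m y)) dvdzBC residue_eq.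
Qed.

Lemma is_cd_word_rem i w : is_cd_word w -> is_cd_word (rem i w).
Proof.
move=> /andP[uw pw]; rewrite /is_cd_word rem_uniq //=.
exact: subseq_pairwise (rem_subseq _ _) pw.
Qed.

Lemma Aw_cd_word w w' c : is_cd_word w -> is_cd_word w' -> w =i w' ->
  Aw (intw w) c = Aw (intw w') c.
Proof.
move=> cw cw' E; apply/funext => v; rewrite !AwE -!/(wprod _) (cd_wprod_unique cw cw' E).
by rewrite !size_map -!len_cd_wprod // (cd_wprod_unique cw cw' E).
Qed.

(* With u the element of J, i |-> u (i + 1) permutes the residues and fixes those in J, so it permutes
   the complement of J. *)
Lemma sum_exchange_compl J (x y : 'I_n) : J != [set: 'I_n]%SET ->
  \sum_(i | i \notin J) ((x == i)%:R -
    (x == residue m (wprod (cd_word J) ((i : nat)%:Z + 1)))%:R) = 0 :> int.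
Proof.
move=> /cd_wordP[cw eJ]; pose s i := residue m (wprod (cd_word J) ((i : nat)%:Z + 1)).
have s_inj : injective s.
  move=> i k /eqP; rewrite /s residue_eq => E; apply/eqP; rewrite -ord_dvd.
  have := rpredB E (residueP m (wprod (cd_word J) ((k : nat)%:Z + 1))).
  by rewrite opprB addrA subrK aff_dvd opprD addrACA subrr addr0.
have sJ i : i \in J -> s i = i.
  by move=> iJ; rewrite /s cd_wprod_descent ?eJ // residue_val.
have -> : \sum_(i | i \notin J) ((x == i)%:R - (x == s i)%:R) =
  \sum_i ((x == i)%:R - (x == s i)%:R) :> int.
  rewrite [RHS](bigID (mem J)) /= [X in X + _]big1 ?add0r // => i iJ.
  by rewrite sJ // subrr.
by rewrite sumrB [X in X - _](reindex_inj s_inj) /= subrr.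
Qed.

Definition cd_sum (k : nat) c v : int :=
  \sum_(J : {set 'I_n} | (#|J| == k) && (J != [set: 'I_n]%SET)) Aw (intw (cd_word J)) c v.

(* Deleting the letter [i] from the word of [J] leaves a word for [J :\ i]; so the
   correction terms group according to [J :\ i], where they telescope. *)
Lemma chevalley_cd_sum r (k : nat) c v : chevalley r (cd_sum k c) v = cd_sum k (chevalley r c) v.
Proof.
rewrite /cd_sum chevalley_sum.
pose x := residue m (v r).
pose B J i : int := (x == i)%:R - (x == residue m (wprod (cd_word J) ((i : nat)%:Z + 1)))%:R.
pose A J := Aw (intw (cd_word J)) c v.
have E J : J != [set: 'I_n]%SET -> chevalley r (Aw (intw (cd_word J)) c) v = Aw (intw (cd_word J)) (chevalley r c) v +
   \sum_(i in J) B (J :\ i)%SET i * A (J :\ i)%SET.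
  move=> JT; have [cw eJ] := cd_wordP JT.
  have inj : injective (fun i : 'I_n => (i : nat)%:Z) by move=> i j [] /val_inj.
  have uw : uniq (cd_word J) by case/andP: cw.
  rewrite chevalley_Aw ?map_inj_uniq //; congr (_ + _).
  rewrite big_map big_uniq //=; apply: eq_big => i; first by rewrite eJ.
  move=> iw; have JiT : (J :\ i)%SET != [set: 'I_n]%SET.
    by apply/eqP => /(congr1 (fun K : {set 'I_n} => i \in K)); rewrite !inE eqxx.
  have [cw' eJ'] := cd_wordP JiT.
  have er : rem i (cd_word J) =i cd_word (J :\ i)%SET.
    by move=> j; rewrite mem_rem_uniq // !inE eJ' !inE eJ.
  rewrite index_intw -map_take rem_intw (Aw_cd_word c (is_cd_word_rem i cw) cw' er).
  by rewrite (chi_pre _ cw iw) (cd_wprod_unique (is_cd_word_rem i cw) cw' er).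
under eq_bigr => J /andP[_ JT] do rewrite E //.
rewrite big_split /=; set S := (X in _ + X); suff -> : S = 0 by rewrite addr0.
rewrite /S (exchange_big_dep predT) //=.
have R i : \sum_(J : {set 'I_n} | ((#|J| == k) && (J != [set: 'I_n]%SET)) && (i \in J))
      B (J :\ i)%SET i * A (J :\ i)%SET =
    \sum_(K : {set 'I_n} | (#|K|.+1 == k) && ((i \notin K) && ((i |: K)%SET != [set: 'I_n]%SET)))
      B K i * A K.
  rewrite (reindex_onto (fun K => i |: K)%SET (fun K => K :\ i)%SET); last first.
    by move=> K /andP[_ iK]; rewrite finset.setD1K.
  apply: eq_big => [K|K /andP[_ /eqP ->//]].
  rewrite finset.setU11 andbT cardsU1.
  have [iK|iK] /= := boolP (i \in K); last by rewrite finset.setU1K // eqxx andbT.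
  have -> : ((i |: K) :\ i == K)%SET = false.
    by apply/eqP => /setP/(_ i); rewrite !inE eqxx iK.
  by rewrite !andbF.
under eq_bigr do rewrite R.
rewrite (exchange_big_dep (fun K : {set 'I_n} => #|K|.+1 == k)) /=; last first.
  by move=> i K _ /andP[].
apply: big1 => K kK; rewrite kK /= -mulr_suml.
have [->|] := eqVneq (\sum_(i | (i \notin K) && ((i |: K)%SET != [set: 'I_n]%SET)) B K i) 0.
  by rewrite mul0r.
have [[i0 i0K iT]|nex] := pselect (exists2 i, i \notin K & (i |: K)%SET = [set: 'I_n]%SET).
  rewrite big1 ?eqxx // => i /andP[iK]; have : i \in (i0 |: K)%SET by rewrite iT inE.
  by rewrite !inE (negPf iK) orbF => /eqP ->; rewrite iT eqxx.
rewrite (eq_bigl (fun i => i \notin K)); last first.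
  move=> i; have [iK|//] /= := boolP (i \notin K).
  by apply/eqP => iT; apply: nex; exists i.
have [->|KT] := eqVneq K [set: 'I_n]%SET.
  by rewrite big_pred0 ?eqxx // => i; rewrite inE.
by rewrite sum_exchange_compl ?eqxx.
Qed.
End FominStanley.

Section StanleyCoefficients.
Variable m : nat.
Local Notation n := m.+2.
Implicit Types (u v w : affperm n) (r x : int) (a : nat -> nat) (N : nat).
Implicit Types (f : nat -> affperm n).

Fixpoint cd_sums N a : affperm n -> int :=
  if N is N'.+1 then cd_sum (a 0%N) (cd_sums N' (fun k => a k.+1)) else fun w => (w == 1%A)%:R.

Lemma chevalley_cd_sums r N a v : chevalley r (cd_sums N a) v = 0.
Proof.
elim: N a v => [|N IH] a v /=.
  apply: fsbig1 => j Cj; have [E|] := eqVneq; last by rewrite mulr0.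
  by move: Cj; rewrite /upper_covers /= E len1.
rewrite chevalley_cd_sum; have -> : chevalley r (cd_sums N (fun k => a k.+1)) = fun=> 0 by apply/funext => u.
by rewrite /cd_sum big1 // => J _; rewrite AwE; case: ifP.
Qed.

Definition prefix_prod N f : affperm n := (\prod_(k < N) f k)%g.

Lemma prefix_prodS N f : prefix_prod N.+1 f = (f 0%N * prefix_prod N (fun k => f k.+1))%A.
Proof. by rewrite /prefix_prod big_ord_recl. Qed.

Lemma prefix_prod_widen N M f : (N <= M)%N -> (forall k, (N <= k)%N -> f k = 1%A) -> prefix_prod M f = prefix_prod N f.
Proof.
move=> NM f1; rewrite /prefix_prod -!(big_mkord xpredT f) (big_cat_nat _ NM) //=.
rewrite [X in (_ * X)%g]big_nat [X in (_ * X)%g]big1; last by move=> k /andP[Nk _]; exact: f1.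
exact: affM1.
Qed.

Lemma sum_widen N M a : (N <= M)%N -> (forall k, (N <= k)%N -> a k = 0%N) ->
  (\sum_(k < M) a k = \sum_(k < N) a k)%N.
Proof.
move=> NM a0; rewrite -!(big_mkord xpredT a) (big_cat_nat _ NM) //=.
rewrite [X in (_ + X)%N]big_nat [X in (_ + X)%N]big1 ?addn0 //.
by move=> k /andP[Nk _]; exact: a0.
Qed.

Lemma cyc_decreasing1 : cyc_decreasing (1%A : affperm n).
Proof. by exists [::]; split; rewrite ?word_prod_nil // => v. Qed.

Lemma len_prefix_prod N f : (len (prefix_prod N f) <= \sum_(k < N) len (f k))%N.
Proof.
elim: N f => [|N IH] f; first by rewrite /prefix_prod !big_ord0 len1.
by rewrite prefix_prodS big_ord_recl; apply: leq_trans (lenM _ _) _; rewrite leq_add2l IH.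
Qed.

Definition factorizations N a w : set (nat -> affperm n) :=
  [set f | [/\ forall k, cyc_decreasing (f k), forall k, len (f k) = a k,
     forall k, (N <= k)%N -> f k = 1%A, w = prefix_prod N f
     & len w = (\sum_(k < N) a k)%N]].

Definition scons u f : nat -> affperm n := fun k => if k is k'.+1 then f k' else u.

Lemma factorizationsS N a w f : factorizations N.+1 a w f <->
  [/\ cyc_decreasing (f 0%N), len (f 0%N) = a 0%N,
     (len ((f 0%N)^-1 * w)%A + a 0%N)%N = len w
   & factorizations N (fun k => a k.+1) ((f 0%N)^-1 * w)%A (fun k => f k.+1)].
Proof.
split=> [[fc fl f1 -> lw]|[fc fl lw [gc gl g1 gE gw]]].
  have E : ((f 0%N)^-1 * prefix_prod N.+1 f)%A = prefix_prod N (fun k => f k.+1).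
    by rewrite prefix_prodS affMA affVM aff1M.
  have le := len_prefix_prod N (fun k => f k.+1).
  have le2 : (len (prefix_prod N.+1 f) <= a 0%N + len (prefix_prod N (fun k => f k.+1)))%N.
    by rewrite prefix_prodS -fl; apply: lenM.
  have Es : (\sum_(k < N) len (f k.+1) = \sum_(k < N) a k.+1)%N by apply: eq_bigr.
  have Ea : (\sum_(k < N.+1) a k = a 0%N + \sum_(k < N) a k.+1)%N by rewrite big_ord_recl.
  have lg : len (prefix_prod N (fun k => f k.+1)) = (\sum_(k < N) a k.+1)%N.
    by apply/eqP; rewrite eqn_leq; apply/andP; split; lia.
  split=> //; rewrite E; first by lia.
  by split=> // k Nk; apply: f1.
split; first by case.
- by case.
- by case=> // k Nk; apply: g1.
- by rewrite prefix_prodS -gE affMA affMV aff1M.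
- by rewrite -lw gw big_ord_recl addnC.
Qed.

Lemma factorizations_count N a w : (forall k, (N <= k)%N -> a k = 0%N) ->
  finite_set (factorizations N a w) /\
  \sum_(f \in factorizations N a w) (1 : int) = cd_sums N a w.
Proof.
elim: N a w => [|N IH] a w a0.
  have [->|w1] := eqVneq w 1%A.
    have -> : factorizations 0 a 1%A = [set fun=> 1%A].
      apply/seteqP; split=> f /=; first by move=> [_ _ f1 _ _]; apply/funext => k; apply: f1.
      move=> ->; split=> //; first by move=> k; exact: cyc_decreasing1.
      - by move=> k; rewrite len1 a0.
      - by rewrite /prefix_prod big_ord0.
      - by rewrite len1 big_ord0.
    by rewrite fsbig_set1 /= eqxx; split=> //; exact: finite_set1.
  have -> : factorizations 0 a w = set0.
    apply/seteqP; split=> // f [_ _ _ wE _]; move: w1.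
    by rewrite wE /prefix_prod big_ord0 eqxx.
  by rewrite fsbig_set0 /= (negPf w1); split.
pose a' k := a k.+1; have {IH}IH w' := IH a' w' (fun k Nk => a0 k.+1 Nk).
have finX : finite_set (factorizations N.+1 a w).
  apply: (sub_finite_set (B := \bigcup_(u in [set u : affperm n | (len u <= a 0%N)%N])
     (scons u @` factorizations N a' (u^-1 * w)%A))); last first.
    apply: bigcup_finite; first exact: finite_len.
    by move=> u _; apply: finite_image; case: (IH (u^-1 * w)%A).
  move=> f /factorizationsS [_ fl _ Xf]; exists (f 0%N); first by rewrite /= fl.
  by exists (fun k => f k.+1) => //; apply/funext => -[].
split=> //=.
pose U J := wprod (cd_word J) : affperm n.
pose P (J : {set 'I_n}) := (#|J| == a 0%N) && (J != [set: 'I_n]%SET).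
have one f : factorizations N.+1 a w f -> 1 = \sum_(J | P J) (f 0%N == U J)%:R :> int.
  move=> /factorizationsS [fc fl _ _]; have [J JT fE] := cyc_decreasingP fc.
  have PJ : P J by rewrite /P JT andbT -len_cd_word // -fE fl.
  rewrite (bigD1 J) //= fE eqxx big1 ?addr0 // => K /andP[/andP[_ KT] KJ].
  by have [/wprod_cd_word_inj E|//] := eqVneq; rewrite E ?eqxx in KJ.
transitivity (\sum_(f \in factorizations N.+1 a w) \sum_(J | P J) ((f 0%N == U J)%:R : int)).
  by apply: eq_fsbigr => f /set_mem; exact: one.
rewrite fsbig_finite // exchange_big /=; apply: eq_bigr => J /andP[/eqP cJ JT].
rewrite -fsbig_finite // AwE -/(wprod _) -/(U J) size_map.
have [cw _] := cd_wordP JT; rewrite -len_cd_wprod // -/(U J).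
have lU : len (U J) = a 0%N by rewrite /U len_cd_word.
rewrite -(@fsbig_widen _ _ _ _ (factorizations N.+1 a w `&` [set f | f 0%N = U J])).
- rewrite lU; case: ifP => [/eqP lw|/eqP lw]; last first.
    by apply: fsbig1 => f [/factorizationsS[_ _ E _] /= fU]; case: lw; rewrite -fU.
  case: (IH ((U J)^-1 * w)%A) => _ <-.
  rewrite (reindex_fsbig (scons (U J)) (factorizations N a' ((U J)^-1 * w)%A)).
    by apply: eq_fsbigr => f _; rewrite /= eqxx.
  split.
  - move=> f Xf; split=> //; apply/factorizationsS; split=> //=.
    exact: cyc_decreasing_cd_word.
  - by move=> f g _ _ E; apply/funext => k; have := congr1 (fun e => e k.+1) E.
  - move=> f [/factorizationsS[_ _ _ Xf] /= fU]; exists (fun k => f k.+1).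
      by rewrite -fU.
    by apply/funext => -[].
- by move=> f [].
- move=> f [Xf nf] /=; have [fU|//] := eqVneq; by case: nf.
Qed.

Lemma monom_bound (a : monom) : exists N, forall k, (N <= k)%N -> a k = 0%N.
Proof.
exists (\max_(k <- finsupp a) k).+1 => k Nk; apply: fsfun_dflt.
apply/negP => ka; have : (k <= \max_(j <- finsupp a) j)%N by exact: (leq_bigmax_seq (F := id)).
by rewrite leqNgt Nk.
Qed.

Lemma F_hh (a : monom) N w : (forall k, (N <= k)%N -> a k = 0%N) -> F_ w a = cd_sums N a w.
Proof.
move=> a0; have [_ <-] := factorizations_count w a0.
rewrite /F_ -(@fsbig_widen _ _ _ _ (factorizations N a w)).
- apply: eq_fsbigr => f /set_mem [_ fl _ _ _]; rewrite /xpow.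
  by have -> : `[< a =1 (fun k => len (f k)) >] by apply/asboolP => k; rewrite fl.
- move=> f [fc fl f1 wE lw]; split=> //; exists N; split=> //.
  by rewrite lw; apply: eq_bigr => k _; rewrite fl.
- move=> f [[fc [M [f1 wE lw]]] nX] /=; rewrite /xpow.
  case: asboolP => // fa; exfalso; apply: nX.
  have fl k : len (f k) = a k by rewrite fa.
  have f1' k : (N <= k)%N -> f k = 1%A by move=> Nk; apply: len0; rewrite fl a0.
  have -> : factorizations N a w f = True; last by [].
  apply/propext; split=> // _; split=> //.
    rewrite wE -/(prefix_prod M f) -(prefix_prod_widen (leq_maxl M N)) //.
    by rewrite (prefix_prod_widen (leq_maxr M N)).
  have fM k : (M <= k)%N -> a k = 0%N by move=> Mk; rewrite -fl f1 // len1.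
  rewrite lw; transitivity (\sum_(k < M) a k)%N; first by apply: eq_bigr => k _; rewrite fl.
  by rewrite -(sum_widen (leq_maxl M N)) // (sum_widen (leq_maxr M N)).
Qed.

Lemma chevalley_F r (a : monom) v : chevalley r (fun w => F_ w a) v = 0.
Proof.
have [N a0] := monom_bound a; rewrite -(chevalley_cd_sums r N a v); congr (chevalley r _ v).
by apply/funext => w; exact: F_hh.
Qed.
End StanleyCoefficients.

(** * Atoms of fixed-point-free involutions *)

Section Atoms.
Variable m : nat.
Local Notation n := m.+2.
Implicit Types (u v w y z Th : affperm n) (a b i j k x : int).

Definition near_id Th := forall x, x - 1 <= Th x <= x + 1.
Definition is_Theta Th := Th = Theta_plus n \/ Th = Theta_minus n.

Lemma ndvd_small (d : nat) : (0 < d < n)%N -> ~~ (n%:Z %| d%:Z)%Z.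
Proof. by move=> /andP[d0 dn]; rewrite dvdzE /= gtnNdvd. Qed.

Lemma near_id_prod (o p : nat) : (p.*2 <= n)%N ->
  let P := (\prod_(k < p) s_ n (k.*2.+1 + o)%N%:Z)%g : affperm n in
  near_id P /\ forall k : nat, (p.*2 < k <= n)%N -> P (k + o)%N%:Z = (k + o)%N%:Z.
Proof.
elim: p => [|p IH] pn /=.
  by rewrite big_ord0; split=> [x|k _]; rewrite aff1E; lia.
have [|nr fx] := IH; first by lia.
rewrite big_ord_recr /=; set P := (\prod_(_ < _) _)%g in nr fx *.
pose i := (p.*2.+1 + o)%N%:Z; rewrite -/i.
have fxi x (q : nat) : (p.*2 < q <= n)%N -> (n%:Z %| x - (q + o)%N%:Z)%Z -> P x = x.
  move=> qn /dvdz_ex[k E]; have -> : x = (q + o)%N%:Z + k * n%:Z by rewrite -E; ring.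
  by rewrite aff_shift fx.
split=> [x|k kn]; rewrite affME.
  have [d|d] := boolP (n%:Z %| x - i)%Z.
    rewrite s_l // (fxi _ p.*2.+2) //; first by lia.
      by lia.
    by have -> : x + 1 - (p.*2.+2 + o)%N%:Z = x - i by rewrite /i; lia.
  have [d'|d'] := boolP (n%:Z %| x - (i + 1))%Z; last by rewrite s_out.
  rewrite s_r // (fxi _ p.*2.+1) //; first by lia.
    by lia.
  by have -> : x - 1 - (p.*2.+1 + o)%N%:Z = x - (i + 1) by rewrite /i; lia.
rewrite s_out ?fx //; first by lia.
- have -> : (k + o)%N%:Z - i = (k - p.*2.+1)%N%:Z by rewrite /i; lia.
  by apply: ndvd_small; lia.
- have -> : (k + o)%N%:Z - (i + 1) = (k - p.*2.+2)%N%:Z by rewrite /i; lia.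
  by apply: ndvd_small; lia.
Qed.

Lemma Theta_near Th : is_Theta Th -> near_id Th.
Proof.
have le : (n./2.*2 <= n)%N by have := odd_double_half n; lia.
case=> ->; [have [H _] := near_id_prod 0 le|have [H _] := near_id_prod 1 le]; move=> x;
  have := H x; rewrite /Theta_plus /Theta_minus; under eq_bigr => k _ do rewrite ?addn0 ?addn1; by [].
Qed.

Definition conjugates Th w z := (Th * w)%A = (w * z)%A.

Lemma conjugatesE Th w z : (w^-1 * Th * w)%g = z <-> conjugates Th w z.
Proof.
rewrite /conjugates; split => [<-|E].
  by rewrite [RHS](_ : _ = w * (w^-1 * Th * w))%A // !affMA affMV aff1M.
by rewrite [LHS](_ : _ = w^-1 * Th * w)%A // -affMA E affMA affVM aff1M.
Qed.

Lemma conjugates_t Th w z a b : conjugates Th w z ->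
  conjugates Th (w * t_ n a b)%A (t_ n a b * z * t_ n a b)%A.
Proof.
rewrite /conjugates => E; rewrite affMA E !affMA.
by rewrite -[(w * t_ n a b * t_ n a b)%A]affMA ttK affM1.
Qed.

Lemma conjugates_len Th w z : conjugates Th w z -> (len z <= 2 * len w + len Th)%N.
Proof.
move=> E; have -> : z = (w^-1 * (Th * w))%A by rewrite E affMA affVM aff1M.
have := lenM (w^-1)%A (Th * w)%A; have := lenM Th w; rewrite lenV; lia.
Qed.

Lemma conjugates_inversion Th w z a b : near_id Th -> conjugates Th w z -> a < b -> z b < z a ->
  [\/ w b < w a, w (z a) < w (z b) | z a = b].
Proof.
move=> nr E ab zab; have Ex x : Th (w x) = w (z x) by rewrite -!affME E.
have [lt|] := ltP (w b) (w a); first by constructor 1.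
rewrite le_eqVlt => /predU1P[/aff_inj|lt]; first by lia.
have [lt2|] := ltP (w (z a)) (w (z b)); first by constructor 2.
rewrite le_eqVlt => /predU1P[/aff_inj|lt2]; first by lia.
rewrite -!Ex in lt2; have [_ E2] := near_id_inversion nr lt lt2.
by constructor 3; move: E2; rewrite Ex => /aff_inj.
Qed.

Lemma FPF_K z x : I_FPF z -> z (z x) = x. Proof. by move=> /(_ x)[]. Qed.

Lemma FPF_ndvd z x : I_FPF z -> ~~ (n%:Z %| z x - x)%Z.
Proof.
move=> Fz; apply/negP => /dvdz_ex[k E].
have Ez : z x = x + k * n%:Z by rewrite -E; ring.
have := FPF_K x Fz; rewrite Ez aff_shift Ez => kn.
by have [_] := Fz x; rewrite Ez; lia.
Qed.

Lemma FPF_dvd z a b : I_FPF z -> (n%:Z %| z a - b)%Z = (n%:Z %| a - z b)%Z.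
Proof. by move=> Fz; rewrite -{1}(FPF_K b Fz) aff_dvd. Qed.

Lemma FPF_t z a b : I_FPF z -> I_FPF (t_ n a b * z * t_ n a b)%A.
Proof.
have tK x : t_ n a b (t_ n a b x) = x by rewrite -affME ttK.
move=> Fz x; rewrite !affME tK FPF_K // tK; split=> // E.
have [_ nE] := Fz (t_ n a b x); apply: nE.
by rewrite {1}E tK.
Qed.

Lemma FPF_inv z : I_FPF z -> (z^-1)%A = z.
Proof.
by move=> Fz; apply: (@affI _ z); rewrite affMV; apply: affpermP => x; rewrite affME FPF_K.
Qed.

Lemma t_commute a b c d : ~~ (n%:Z %| c - a)%Z -> ~~ (n%:Z %| c - b)%Z ->
  ~~ (n%:Z %| d - a)%Z -> ~~ (n%:Z %| d - b)%Z ->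
  (t_ n a b * t_ n c d)%A = (t_ n c d * t_ n a b)%A.
Proof. by move=> *; rewrite t_conj !t_out. Qed.

(* In this section and Mate2, t' = z t z is the mate of t: the conjugates of z by the
   commuting reflections t and t' coincide. *)
Section Mate.
Variables (z : affperm n) (a b : int).
Hypotheses (Fz : I_FPF z) (ab : ~~ (n%:Z %| b - a)%Z) (zab : ~~ (n%:Z %| z a - b)%Z).
Let t := t_ n a b.
Let t' := t_ n (z a) (z b).

Let zba : ~~ (n%:Z %| z b - a)%Z. Proof. by rewrite FPF_dvd // dvdzBC. Qed.

Lemma mate_zt : (z * t)%A = (t' * z)%A. Proof. exact: t_conj. Qed.

Lemma mate_commute : (t * t')%A = (t' * t)%A.
Proof. by apply: t_commute => //; exact: FPF_ndvd. Qed.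

Lemma mate_tz : (z * t')%A = (t * z)%A.
Proof. by rewrite /t' t_conj !FPF_K. Qed.

Lemma mate_conj : (t' * z * t')%A = (t * z * t)%A.
Proof. by rewrite -mate_zt -affMA mate_commute affMA mate_tz. Qed.

Lemma mate_za : (t * z * t)%A a = z b.
Proof. by rewrite !affME t_l // t_out //; exact: FPF_ndvd. Qed.

Lemma mate_zb : (t * z * t)%A b = z a.
Proof. by rewrite !affME t_r // t_out //; exact: FPF_ndvd. Qed.

End Mate.

Definition inverts z a b : bool := (b - a) * (z b - z a) < 0.

Lemma invertsE w a b : ~~ (n%:Z %| b - a)%Z -> (len (w * t_ n a b)%A < len w)%N = inverts w a b.
Proof.
rewrite /inverts => d; have [lt|] := ltP a b.
  by rewrite len_invE // pmulr_rlt0 ?subr_gt0 // subr_lt0.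
rewrite le_eqVlt => /predU1P[E|lt]; first by rewrite E subrr dvdz0 in d.
by rewrite t_sym len_invE 1?dvdzBC // nmulr_rlt0 ?subr_lt0 // subr_gt0.
Qed.

Lemma ninvertsE w a b : ~~ (n%:Z %| b - a)%Z ->
  (len w < len (w * t_ n a b)%A)%N = ~~ inverts w a b.
Proof.
move=> d; have := invertsE (w * t_ n a b)%A d; rewrite -affMA ttK affM1 => ->.
rewrite /inverts !affME t_l // t_r //.
have : b != a by apply: contraNneq d => ->; rewrite subrr dvdz0.
have : w b != w a by apply: contraNneq d => /aff_inj ->; rewrite subrr dvdz0.
nia.
Qed.

Lemma inverts_sym w a b : inverts w a b = inverts w b a.
Proof. by rewrite /inverts -mulrNN !opprB. Qed.

Lemma inverts_eq w v a b : w a = v a -> w b = v b -> inverts w a b = inverts v a b.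
Proof. by rewrite /inverts => -> ->. Qed.

Section Mate2.
Variables (z : affperm n) (a b : int).
Hypotheses (Fz : I_FPF z) (ab : ~~ (n%:Z %| b - a)%Z) (zab : ~~ (n%:Z %| z a - b)%Z).
Let t := t_ n a b.
Let t' := t_ n (z a) (z b).
Let zba : ~~ (n%:Z %| z b - a)%Z. Proof. by rewrite FPF_dvd // dvdzBC. Qed.
Let zz : ~~ (n%:Z %| z b - z a)%Z. Proof. by rewrite aff_dvd. Qed.

Lemma len_conj_up : ~~ inverts z a b -> (len z + 2 <= len (t * z * t)%A)%N.
Proof.
move=> ni; have l1 : (len z < len (z * t)%A)%N by rewrite ninvertsE.
have l2 : (len (t * z)%A < len (t * z * t)%A)%N.
  rewrite ninvertsE // (@inverts_eq _ z) // affME t_out //; exact: FPF_ndvd.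
have : len (t * z)%A = len (z * t)%A by rewrite -lenV aff_invM tV FPF_inv.
lia.
Qed.

Lemma len_conj_down : inverts z a b -> (len (t * z * t)%A + 2 <= len z)%N.
Proof.
move=> ni; have l1 : (len (z * t)%A < len z)%N by rewrite invertsE.
have l2 : (len (t * z * t)%A < len (t * z)%A)%N.
  rewrite invertsE // (@inverts_eq _ z) // affME t_out //; exact: FPF_ndvd.
have : len (t * z)%A = len (z * t)%A by rewrite -lenV aff_invM tV FPF_inv.
lia.
Qed.

Lemma len_mate w : (len (w * t * t')%A < len (w * t)%A)%N = (len (w * t')%A < len w)%N.
Proof.
by rewrite !invertsE //; apply: inverts_eq; rewrite affME t_out //; exact: FPF_ndvd.
Qed.

Lemma conjugates_mate Th w : near_id Th -> conjugates Th w z -> inverts z a b ->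
  (len (w * t)%A < len w)%N \/ (len (w * t')%A < len w)%N.
Proof.
have H c d : ~~ (n%:Z %| d - c)%Z -> ~~ (n%:Z %| z c - d)%Z -> near_id Th -> conjugates Th w z ->
    c < d -> inverts z c d ->
    (len (w * t_ n c d)%A < len w)%N \/ (len (w * t_ n (z c) (z d))%A < len w)%N.
  move=> dc zcd nr E cd; rewrite !invertsE ?aff_dvd //.
  rewrite /inverts pmulr_rlt0 ?subr_gt0 // subr_lt0 => zlt.
  case: (conjugates_inversion nr E cd zlt) => [lt|lt|Ez].
  - by left; rewrite pmulr_rlt0 ?subr_gt0 // subr_lt0.
  - by right; rewrite nmulr_rlt0 ?subr_lt0 // subr_gt0.
  - by rewrite Ez subrr dvdz0 in zcd.
move=> nr E; have [lt|] := ltP a b; first exact: H.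
rewrite le_eqVlt => /predU1P[Eq|lt]; first by move: ab; rewrite Eq subrr dvdz0.
rewrite inverts_sym /t /t' t_sym [t_ n (z a) _]t_sym; apply: H => //.
by rewrite dvdzBC.
Qed.
End Mate2.

(* By induction on a minimal w = w1 s: if conjugation by s did not lengthen
   w1^-1 Th w1, then deleting s, or multiplying w1 by s or its mate, would give
   something shorter than w. *)
Lemma reduced_atom_len Th w z : near_id Th -> I_FPF z -> conjugates Th w z ->
  (forall v, conjugates Th v z -> (len w <= len v)%N) -> (2 * len w + len Th = len z)%N.
Proof.
move=> nr; move: {2}(len w) (erefl (len w)) => d; elim: d w z => [|d IH] w z lw Fz E mn.
  have w1 := len0 lw; move: E; rewrite w1 /conjugates affM1 aff1M => ->.
  by rewrite len1.
have [u Eu su] := len_word w; case/lastP: u Eu su => [|u i Eu].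
  by rewrite lw.
rewrite size_rcons lw => -[su].
pose w1 := word_prod n u; pose s := s_ n i.
have Ew : w = (w1 * s)%A by rewrite -Eu -cats1 word_prod_cat word_prod_cons word_prod_nil affM1.
have Ew1 : w1 = (w * s)%A by rewrite Ew -affMA ttK affM1.
have lw1 : len w1 = d.
  have := len_le m u; have := lenM w1 s; have := len_s m i; rewrite -Ew -/w1 -/s; lia.
pose z1 := (s * z * s)%A.
have Ez : z = (s * z1 * s)%A by rewrite /z1 !affMA ttK aff1M -affMA ttK affM1.
have E1 : conjugates Th w1 z1 by rewrite Ew1; exact: conjugates_t.
have F1 : I_FPF z1 by exact: FPF_t.
clearbody z1.
have down v : conjugates Th v z -> (d < len v)%N by move=> /mn; rewrite lw.
have L1 : (2 * d + len Th = len z1)%N.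
  rewrite -lw1; apply: (IH w1 z1) => // v /(@conjugates_t _ _ _ i (i + 1)).
  rewrite -/(s_ n i) -/s -Ez => /down; have := lenM v s; have := len_s m i; rewrite -/s; lia.
have up : (len z <= len z1 + 2)%N.
  rewrite Ez; have := lenM (s * z1)%A s; have := lenM s z1; have := len_s m i; rewrite -/s; lia.
suff : (len z1 + 2 <= len z)%N by lia.
have lti : i < i + 1 by lia.
have nd : ~~ (n%:Z %| i + 1 - i)%Z := s_ndvd m i.
have lws : ~~ (w1 (i + 1) < w1 i).
  by rewrite -len_invE // -/(s_ n i) -/s -Ew lw lw1; lia.
have [lt|ge] := ltP (z1 (i + 1)) (z1 i).
  case: (conjugates_inversion nr E1 lti lt) => [lt1|lt1|zi].
  - by rewrite lt1 in lws.
  - have [d1|d1] := boolP (n%:Z %| z1 i - (i + 1))%Z; last first.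
      exfalso; have iz : inverts z1 i (i + 1) by rewrite /inverts; nia.
      have l1 : (len (w1 * t_ n (z1 i) (z1 (i + 1)%R))%A < len w1)%N.
        rewrite invertsE ?aff_dvd // /inverts; nia.
      have := down (w1 * t_ n (z1 i) (z1 (i + 1)%R))%A; rewrite -lw1.
      move=> H; suff : conjugates Th (w1 * t_ n (z1 i) (z1 (i + 1)%R))%A z by move/H; lia.
      by have := @conjugates_t _ _ _ (z1 i) (z1 (i + 1)) E1; rewrite mate_conj // -/(s_ n i) -/s -Ez.
    have [k Ek] := dvdz_ex d1.
    have zi : z1 i = i + 1 + k * n%:Z by rewrite -Ek; ring.
    have zi1 : z1 (i + 1) = i - k * n%:Z.
      by have := FPF_K i F1; rewrite zi aff_shift; lia.
    exfalso; move: lws lt lt1; rewrite zi zi1.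
    have -> : i - k * n%:Z = i + (- k) * n%:Z by ring.
    rewrite !aff_shift; nia.
  - exfalso; have zi1 : z1 (i + 1) = i by rewrite -zi FPF_K.
    have zz1 : z = z1.
      by rewrite Ez -affMA {2}/s /s_ t_conj zi zi1 t_sym affMA ttK aff1M.
    by have := down w1; rewrite zz1 lw1 => /(_ E1); rewrite ltnn.
have lt : z1 i < z1 (i + 1) by rewrite lt_neqAle ge andbT; apply/eqP => /aff_inj; lia.
have l1 : (len z1 < len (z1 * s)%A)%N by exact: len_ninv.
have l2 : len (z1 * s)%A = len (s * z1)%A by rewrite -[RHS]lenV aff_invM sV FPF_inv.
have l3 : (len (s * z1)%A < len (s * z1 * s)%A)%N.
  apply: len_ninv => //; rewrite !affME ltNge; apply/negP.
  rewrite le_eqVlt => /predU1P[/aff_inj/aff_inj|lt2]; first by lia.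
  have [e1 /dvdz_ex[k Ek]] := s_inversion lt lt2.
  have zi : z1 i = i + k * n%:Z by rewrite -Ek; ring.
  by move: (FPF_ndvd i F1); rewrite zi addrC addKr dvdz_mull.
by rewrite Ez; lia.
Qed.

Lemma atomsP z w : I_FPF z -> atoms_FPF z w <->
  exists Th, [/\ is_Theta Th, conjugates Th w z & (2 * len w + len Th = len z)%N].
Proof.
move=> Fz; split=> [[Th [T1 T2 T3]]|[Th [T1 T2 T3]]]; exists Th; split=> //.
- exact/conjugatesE.
- apply: reduced_atom_len => //; [exact: Theta_near|exact/conjugatesE|].
  by move=> v /conjugatesE; exact: T3.
- exact/conjugatesE.
- by move=> v /conjugatesE/conjugates_len; lia.
Qed.
End Atoms.

Lemma fsum_dep (I J : choiceType) (A : set I) (B : I -> set J) (G : I -> J -> int) :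
  finite_set A -> (forall i, A i -> finite_set (B i)) ->
  \sum_(i \in A) \sum_(j \in B i) G i j =
  \sum_(p \in [set p : I * J | A p.1 /\ B p.1 p.2]) G p.1 p.2.
Proof.
move=> fA fB; pose U := \bigcup_(i in A) B i.
have fU : finite_set U by exact: bigcup_finite.
pose H i j : int := if `[< B i j >] then G i j else 0.
have -> : \sum_(i \in A) \sum_(j \in B i) G i j = \sum_(i \in A) \sum_(j \in U) H i j.
  apply: eq_fsbigr => i /set_mem Ai; rewrite -[RHS](@fsbig_widen _ _ _ _ (B i)).
  - by apply: eq_fsbigr => j /set_mem Bij; rewrite /H asboolT.
  - by move=> j Bij; exists i.
  - by move=> j [_ nB]; rewrite /= /H asboolF.
rewrite pair_fsbig // -[LHS](@fsbig_widen _ _ _ _ [set p : I * J | A p.1 /\ B p.1 p.2]).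
- by apply: eq_fsbigr => p /set_mem [_ Bp]; rewrite /H asboolT.
- by move=> p [Ap Bp]; split=> //; exists p.1.
- by move=> p [[Ap _] nB] /=; rewrite /H asboolF // => Bp; apply: nB.
Qed.

Lemma fsum_dep_finite (I J : choiceType) (A : set I) (B : I -> set J) :
  finite_set A -> (forall i, A i -> finite_set (B i)) ->
  finite_set [set p : I * J | A p.1 /\ B p.1 p.2].
Proof. exact: finite_setXR. Qed.

Lemma fsum_cancel (I : choiceType) (A : set I) (phi : I -> I) (G : I -> int) :
  (forall i, A i -> A (phi i)) -> (forall i, A i -> phi (phi i) = i) ->
  (forall i, A i -> G (phi i) = - G i) -> finite_set A -> \sum_(i \in A) G i = 0.
Proof.
move=> Aphi phiK Gphi fA; set S := (X in X = _).
suff : S = - S by lia.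
rewrite {1}/S (reindex_fsbig phi A); last first.
  split=> [i|i j /set_mem Ai /set_mem Aj E|i Ai]; first exact: Aphi.
    by rewrite -(phiK i) // E phiK.
  by exists (phi i); [exact: Aphi|exact: phiK].
rewrite /S !fsbig_finite // -sumrN big_seq [RHS]big_seq; apply: eq_bigr => i.
by rewrite in_fset_set // => /set_mem; exact: Gphi.
Qed.

(** * Cancellation and the bijection with atoms of the covers *)

Section Transition.
Variable m : nat.
Local Notation n := m.+2.
Implicit Types (u v w z Th : affperm n) (a b i j k x e : int).
Variables (y : affperm n) (r : int).
Hypothesis Fy : I_FPF y.

Let ends : set int := [set r; y r].
Let cell := (affperm n * (int * int))%type.
Implicit Types (o : cell).

Let upper o := (o.1 * t_ n o.2.1 o.2.2)%A.

(* The cell (w, (e, j)) stands for the cover w t_{ej} of the atom w of y. *)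
Definition covers_of : set cell :=
  [set o | atoms_FPF y o.1 /\ (ends o.2.1 /\ upper_covers o.1 o.2.1 o.2.2)].

Lemma ends_y e : ends e -> ends (y e).
Proof. by case=> ->; [right|left; rewrite FPF_K]. Qed.

Lemma ends_neq e e' : ends e -> ends e' -> e != e' -> e' = y e.
Proof. by case=> -> [] -> //; rewrite ?eqxx // FPF_K. Qed.

Lemma finite_atoms z : I_FPF z -> finite_set (atoms_FPF z).
Proof.
move=> Fz; apply: sub_finite_set (finite_len m (len z)) => w /(atomsP _ Fz)[Th [_ _ E]] /=.
by lia.
Qed.

Lemma finite_covers_of : finite_set covers_of.
Proof.
apply: (@fsum_dep_finite _ _ _ (fun w => [set q : int * int | ends q.1 /\ upper_covers w q.1 q.2])).
  exact: finite_atoms.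
move=> w _; apply: (@fsum_dep_finite _ _ ends (fun e => upper_covers w e)).
  by rewrite finite_setU; split; exact: finite_set1.
by move=> e _; exact: finite_upper_covers.
Qed.

Variable c : affperm n -> int.
Hypothesis chevalley_c : forall e v, chevalley e c v = 0.

Lemma sum_covers : \sum_(o \in covers_of) Num.sg (o.2.2 - o.2.1) * c (upper o) = 0.
Proof.
rewrite -(@fsum_dep _ _ (atoms_FPF y) (fun w => [set q : int * int | ends q.1 /\ upper_covers w q.1 q.2])
  (fun w q => Num.sg (q.2 - q.1) * c (w * t_ n q.1 q.2)%A)); last first.
- move=> w _; apply: (@fsum_dep_finite _ _ ends (fun e => upper_covers w e)).
    by rewrite finite_setU; split; exact: finite_set1.
  by move=> e _; exact: finite_upper_covers.
- exact: finite_atoms.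
apply: fsbig1 => w _.
rewrite -(@fsum_dep _ _ ends (fun e => upper_covers w e)
  (fun e j => Num.sg (j - e) * c (w * t_ n e j)%A)); last first.
- by move=> e _; exact: finite_upper_covers.
- by rewrite finite_setU; split; exact: finite_set1.
by apply: fsbig1 => e _; exact: chevalley_c.
Qed.

Definition good o : Prop :=
  ~~ (n%:Z %| o.2.2 - y o.2.1)%Z /\ ~~ inverts y o.2.1 o.2.2.

(* The sign-reversing involution on the cells that are not good. *)
Let phi o : cell :=
  if (n%:Z %| o.2.2 - y o.2.1)%Z then (o.1, (y o.2.1, o.2.1 + y o.2.1 - o.2.2))
  else ((upper o * t_ n (y o.2.1) (y o.2.2))%A, (y o.2.1, y o.2.2)).

Lemma swap_shift a b j : (n%:Z %| j - b)%Z -> t_ n b (a + b - j) = t_ n a j.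
Proof.
move=> /dvdz_ex[k E]; have Ej : j = b + k * n%:Z by rewrite -E; ring.
rewrite t_sym -(t_shift _ _ b k); congr t_; rewrite Ej; ring.
Qed.

Lemma sum_bad : \sum_(o \in covers_of `&` ~` good) Num.sg (o.2.2 - o.2.1) * c (upper o) = 0.
Proof.
have sub e j : (n%:Z %| j - y e)%Z = (n%:Z %| y j - e)%Z.
  by rewrite [RHS]FPF_dvd.
have key o : (covers_of `&` ~` good) o -> [/\ (covers_of `&` ~` good) (phi o), phi (phi o) = o,
    upper (phi o) = upper o & Num.sg ((phi o).2.2 - (phi o).2.1) = - Num.sg (o.2.2 - o.2.1)].
  case: o => w [e j] [[/= Aw [Ee Cj]]]; rewrite /good /= => nG.
  have dj := upper_covers_ndvd Cj.
  rewrite /phi /=; have [d|d] := boolP (n%:Z %| j - y e)%Z => /=.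
    have Et := swap_shift e d.
    have d' : (n%:Z %| e + y e - j - e)%Z.
      have -> : e + y e - j - e = - (j - y e) by ring.
      by rewrite rpredN.
    rewrite /upper /= FPF_K // d' /=; split.
    - split; first by split=> //=; split; [exact: ends_y|rewrite /upper_covers /= Et].
      by case.
    - by congr (_, (_, _)); ring.
    - by rewrite Et.
    - rewrite -sgrN; congr Num.sg; ring.
  have iv : inverts y e j by apply/negPn/negP => ni; apply: nG.
  have d2 : ~~ (n%:Z %| y e - j)%Z by rewrite dvdzBC.
  have d3 : ~~ (n%:Z %| y j - e)%Z by rewrite -sub.
  have [Th [TT E L]] := (atomsP _ Fy).1 Aw.
  set w' := (w * t_ n e j * t_ n (y e) (y j))%A.
  have E' : conjugates Th w' y.
    have := conjugates_t (y e) (y j) (conjugates_t e j E).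
    by rewrite -(mate_conj Fy d2) !affMA ttK aff1M -[(y * _ * _)%A]affMA ttK affM1.
  have lw' : len w' = len w.
    have := conjugates_len E'; case: (conjugates_mate Fy dj d2 (Theta_near TT) E iv).
      by rewrite Cj; lia.
    by rewrite -(len_mate Fy dj d2 w) Cj -/w'; lia.
  have twE : (w' * t_ n (y e) (y j))%A = (w * t_ n e j)%A by rewrite /w' -affMA ttK affM1.
  rewrite FPF_K // (negPf d3) /= /upper /= !FPF_K //; split.
  - split.
      split; first by apply/(atomsP _ Fy); exists Th; split=> //; rewrite lw'.
      by split; [exact: ends_y|rewrite /upper_covers /= twE lw'].
    by case=> _ /=; rewrite /inverts !FPF_K // mulrC -/(inverts y e j) iv.
  - by rewrite twE -affMA ttK affM1.
  - exact: twE.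
  - move: iv; rewrite /inverts; have [lt|] := ltP e j.
      rewrite pmulr_rlt0 ?subr_gt0 // => lt2.
      by rewrite (ltr0_sg lt2) gtr0_sg ?subr_gt0.
    rewrite le_eqVlt => /predU1P[Eq|lt]; first by rewrite Eq subrr mul0r.
    rewrite nmulr_rlt0 ?subr_lt0 // => gt2.
    by rewrite (gtr0_sg gt2) ltr0_sg ?subr_lt0 // opprK.
apply: (fsum_cancel (phi := phi)) => [o /key[]//|o /key[]//|o /key[_ _ -> ->]|].
  by rewrite mulNr.
exact/sub_finite_set/finite_covers_of.
Qed.

Lemma inverts_lt w a b : a < b -> inverts w a b = (w b < w a).
Proof. by move=> lt; rewrite /inverts pmulr_rlt0 ?subr_gt0 // subr_lt0. Qed.
Lemma inverts_gt w a b : b < a -> inverts w a b = (w a < w b).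
Proof. by move=> lt; rewrite inverts_sym inverts_lt. Qed.

Definition good_side (s : int) : set cell :=
  [set o | [/\ covers_of o, ~~ (n%:Z %| o.2.2 - y o.2.1)%Z,
     0 < s * (o.2.2 - o.2.1) & 0 < s * (y o.2.2 - y o.2.1)]].

Lemma sum_good_sides : \sum_(o \in good_side (-1)) c (upper o) = \sum_(o \in good_side 1) c (upper o).
Proof.
have fcov := finite_covers_of.
have := sum_covers; rewrite (fsbigID good) //= sum_bad addr0.
rewrite (fsbigID [set o | o.2.1 < o.2.2]) /=; last by apply: sub_finite_set fcov => o [].
have neq w e j : upper_covers w e j -> (j != e) /\ (y j != y e).
  move/upper_covers_ndvd => d; split; apply: contraNneq d; first by move=> ->; rewrite subrr dvdz0.
  by move=> /aff_inj ->; rewrite subrr dvdz0.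
have -> : covers_of `&` good `&` [set o | o.2.1 < o.2.2] = good_side 1.
  apply/seteqP; split=> -[w [e j]] /=.
    move=> [[co [d iv]] lt]; have [_ [_ /neq[/= ne1 ne2]]] := co.
    by split=> //=; move: iv; rewrite /= ?inverts_lt //; lia.
  move=> [co d /= p1 p2]; split; last by lia.
  by split=> //; split=> //=; rewrite inverts_lt; lia.
have -> : covers_of `&` good `&` ~` [set o | o.2.1 < o.2.2] = good_side (-1).
  apply/seteqP; split=> -[w [e j]] /=.
    move=> [[co [d iv]] /negP lt]; have [_ [_ /neq[/= ne1 ne2]]] := co.
    by split=> //=; move: iv; rewrite /= ?inverts_gt //; lia.
  move=> [co d /= p1 p2]; split; last by apply/negP; lia.
  by split=> //; split=> //=; rewrite inverts_gt; lia.
rewrite (eq_fsbigr (fun o => c (upper o))); last first.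
  by move=> o /set_mem[_ _ p _]; rewrite gtr0_sg ?mul1r //; move: p; rewrite mul1r.
rewrite [X in _ + X](eq_fsbigr (fun o => - c (upper o))); last first.
  move=> o /set_mem[_ _ p _]; rewrite ltr0_sg ?mulN1r //.
  by move: p; rewrite mulN1r oppr_gt0.
rewrite !fsbig_finite; try by apply: sub_finite_set fcov => o [].
by rewrite sumrN => /eqP; rewrite subr_eq0 => /eqP ->.
Qed.

Definition Pi_side (s : int) : set (affperm n) :=
  [set z | exists j, [/\ 0 < s * (j - r), ~~ (n%:Z %| j - r)%Z, ~~ (n%:Z %| j - y r)%Z,
     len z = (len y + 2)%N & z = (t_ n r j * y * t_ n r j)%A]].

Lemma Pi_side_FPF s z : Pi_side s z -> I_FPF z.
Proof. by case=> j [_ _ _ _ ->]; exact: FPF_t. Qed.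

Lemma finite_Pi_side s : finite_set (Pi_side s).
Proof.
apply: sub_finite_set (finite_len m (len y + 2)) => z [j [_ _ _ + _]] /=.
by move=> ->.
Qed.

Lemma inverts_side (s : int) w a b : s = 1 \/ s = -1 -> w b != w a -> 0 < s * (b - a) ->
  inverts w a b = ~~ (0 < s * (w b - w a)).
Proof.
case=> -> ne p; first by rewrite inverts_lt; lia.
by rewrite inverts_gt; lia.
Qed.

Lemma good_atom w e j : atoms_FPF y w -> upper_covers w e j -> ~~ (n%:Z %| j - y e)%Z ->
  ~~ inverts y e j ->
  atoms_FPF (t_ n e j * y * t_ n e j)%A (w * t_ n e j)%A /\
  len (t_ n e j * y * t_ n e j)%A = (len y + 2)%N.
Proof.
move=> /(atomsP _ Fy)[Th [TT E L]] Cj d ni; have dj := upper_covers_ndvd Cj.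
have d2 : ~~ (n%:Z %| y e - j)%Z by rewrite dvdzBC.
have E' := conjugates_t e j E; have := conjugates_len E'; rewrite Cj => le.
have ge := len_conj_up Fy dj d2 ni.
have lE : len (t_ n e j * y * t_ n e j)%A = (len y + 2)%N by lia.
split=> //; apply/atomsP; first exact: FPF_t.
by exists Th; split=> //; rewrite Cj lE; lia.
Qed.

Lemma atom_not_both z v a b : I_FPF z -> ~~ (n%:Z %| b - a)%Z -> ~~ (n%:Z %| z a - b)%Z ->
  atoms_FPF z v -> (len (v * t_ n a b)%A < len v)%N ->
  ~~ (len (v * t_ n (z a) (z b))%A < len v)%N.
Proof.
move=> Fz ab zab /(atomsP _ Fz)[Th [TT E L]] l1; apply/negP => l2.
have l3 : (len (v * t_ n a b * t_ n (z a) (z b))%A < len (v * t_ n a b)%A)%N by rewrite len_mate.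
have E' : conjugates Th (v * t_ n a b * t_ n (z a) (z b))%A z.
  have := conjugates_t (z a) (z b) (conjugates_t a b E).
  by rewrite -(mate_conj Fz zab) !affMA ttK aff1M -[(z * _ * _)%A]affMA ttK affM1.
by have := conjugates_len E'; lia.
Qed.

Lemma sum_side s : s = 1 \/ s = -1 ->
  \sum_(o \in good_side s) c (upper o) = \sum_(z \in Pi_side s) \sum_(v \in atoms_FPF z) c v.
Proof.
move=> hs.
have ni a b : 0 < s * (b - a) -> 0 < s * (y b - y a) -> ~~ inverts y a b.
  by move=> p1 p2; rewrite (@inverts_side s) ?p2 //; apply: contraTneq p2 => ->; rewrite subrr mulr0.
rewrite (@fsum_dep _ _ (Pi_side s) (fun z => atoms_FPF z) (fun z v => c v)); last first.
- by move=> z /Pi_side_FPF; exact: finite_atoms.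
- exact: finite_Pi_side.
pose psi o : affperm n * affperm n :=
  ((t_ n o.2.1 o.2.2 * y * t_ n o.2.1 o.2.2)%A, upper o).
rewrite [RHS](reindex_fsbig psi (good_side s)) //; split.
- move=> [w [e j]] [[/= Aw [Ee Cj]] d p1 p2]; have dj := upper_covers_ndvd Cj.
  have [at' lz] := good_atom Aw Cj d (ni _ _ p1 p2).
  split=> //=; case: Ee => Ee; first by exists j; rewrite -Ee.
  have er : y e = r by rewrite Ee FPF_K.
  exists (y j); split=> //; first by rewrite -er.
  + by rewrite -er aff_dvd.
  + by rewrite -Ee FPF_dvd // er FPF_dvd // -Ee.
  + have dd : ~~ (n%:Z %| y e - j)%Z by rewrite dvdzBC.
    by rewrite -(mate_conj Fy dd) er.
- move=> [w [e j]] [w2 [e2 j2]] /set_mem[[/= Aw [Ee Cj]] d p1 p2].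
  move=> /set_mem[[/= Aw2 [Ee2 Cj2]] d2 p12 p22] Eo.
  have Ez : (t_ n e j * y * t_ n e j)%A = (t_ n e2 j2 * y * t_ n e2 j2)%A := congr1 fst Eo.
  have Ev : (w * t_ n e j)%A = (w2 * t_ n e2 j2)%A := congr1 snd Eo.
  have dj := upper_covers_ndvd Cj; have dj2 := upper_covers_ndvd Cj2.
  have dd : ~~ (n%:Z %| y e - j)%Z by rewrite dvdzBC.
  have dd2 : ~~ (n%:Z %| y e2 - j2)%Z by rewrite dvdzBC.
  have za := mate_za Fy dj dd; have za2 := mate_za Fy dj2 dd2.
  have zb2 := mate_zb Fy dj2 dd2.
  have [ee|nee] := eqVneq e e2.
    subst e2; have jj : j = j2 by apply: (aff_inj (u := y)); rewrite -za -za2 Ez.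
    subst j2; congr (_, _); move: Ev => /(congr1 (fun u => (u * t_ n e j)%A)).
    by rewrite -!affMA ttK !affM1.
  exfalso; have e2E := ends_neq Ee Ee2 nee.
  have j2E : j2 = y j.
    have y2 : y e2 = e by rewrite e2E FPF_K.
    by apply: (aff_inj (u := (t_ n e2 j2 * y * t_ n e2 j2)%A)); rewrite zb2 y2 -Ez -za FPF_K //; exact: FPF_t.
  have at' := (good_atom Aw Cj d (ni _ _ p1 p2)).1.
  have Fz : I_FPF (t_ n e j * y * t_ n e j)%A by exact: FPF_t.
  have zd : ~~ (n%:Z %| (t_ n e j * y * t_ n e j)%A e - j)%Z by rewrite za; exact: FPF_ndvd.
  have l1 : (len (w * t_ n e j * t_ n e j)%A < len (w * t_ n e j)%A)%N.
    by rewrite -affMA ttK affM1 Cj.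
  have := atom_not_both Fz dj zd at' l1; rewrite za (mate_zb Fy dj dd) [t_ n (y j) _]t_sym -e2E -j2E.
  by rewrite Ev -affMA ttK affM1 Cj2 ltnSn.
- move=> [z v] [/= [j [p1 d1 d2 lz Ez]] Av].
  have Fz : I_FPF z by rewrite Ez; exact: FPF_t.
  have dd : ~~ (n%:Z %| y r - j)%Z by rewrite dvdzBC.
  have za : z r = y j by rewrite Ez mate_za.
  have zb : z j = y r by rewrite Ez mate_zb.
  have niv : ~~ inverts y r j.
    by apply/negP => iv; have := len_conj_down Fy d1 dd iv; rewrite -Ez lz; lia.
  have ne : y j != y r by apply: contraNneq d1 => /aff_inj ->; rewrite subrr dvdz0.
  have p2 : 0 < s * (y j - y r) by move: niv; rewrite (inverts_side hs ne p1) negbK.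
  have iz : inverts z r j by rewrite (inverts_side hs _ p1) za zb 1?eq_sym //; case: hs p2 => ->; lia.
  have zd : ~~ (n%:Z %| z r - j)%Z by rewrite za; exact: FPF_ndvd.
  have [Th [TT E L]] := (atomsP _ Fz).1 Av.
  have yE : y = (t_ n r j * z * t_ n r j)%A.
    by rewrite Ez !affMA ttK aff1M -affMA ttK affM1.
  have back a b : ~~ (n%:Z %| b - a)%Z -> y = (t_ n a b * z * t_ n a b)%A ->
      (len (v * t_ n a b)%A < len v)%N -> atoms_FPF y (v * t_ n a b)%A /\ upper_covers (v * t_ n a b)%A a b.
    move=> ab yab lt; have E' := conjugates_t a b E; rewrite -yab in E'.
    have := conjugates_len E' => le; split.
      by apply/(atomsP _ Fy); exists Th; split=> //; lia.
    by rewrite /upper_covers /= -affMA ttK affM1; lia.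
  case: (conjugates_mate Fz d1 zd (Theta_near TT) E iz) => lt.
    have [Aw Cw] := back r j d1 yE lt.
    exists ((v * t_ n r j)%A, (r, j)).
      by split=> //; split=> //; split=> //; left.
    by rewrite /psi /upper /= -Ez -affMA ttK affM1.
  rewrite za zb t_sym in lt.
  have d1' : ~~ (n%:Z %| y j - y r)%Z by rewrite aff_dvd.
  have yE' : y = (t_ n (y r) (y j) * z * t_ n (y r) (y j))%A.
    by rewrite t_sym -za -zb mate_conj.
  have [Aw Cw] := back _ _ d1' yE' lt.
  exists ((v * t_ n (y r) (y j))%A, (y r, y j)).
    split; [by split=> //; split=> //; right| by rewrite /= aff_dvd|exact: p2|].
    by rewrite /= !FPF_K.
  rewrite /psi /upper /=; congr (_, _); last by rewrite -affMA ttK affM1.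
  by rewrite (mate_conj Fy dd) -Ez.
Qed.
End Transition.

Lemma covers_F_len (n : nat) (y z : affperm n) (a b : int) : a < b -> ~~ (n%:Z %| b - a)%Z ->
  z = (t_ n a b * y * t_ n a b)%A -> covers_F y z <-> len z = (len y + 2)%N.
Proof.
move=> ab d E.
have H : (len_FPF z = len_FPF y + 1) <-> len z = (len y + 2)%N.
  rewrite /len_FPF; split=> [H|->]; last by rewrite natrD; field.
  have {}H : (len z)%:R = (len y + 2)%N%:R :> rat by rewrite natrD; lra.
  by apply/eqP; rewrite -(eqr_nat rat) H.
split=> [[_ /H]//|/H lz]; split=> //.
by exists (t_ n a b); split=> //; exists a, b; split.
Qed.

Lemma fps_sumE (I : choiceType) (A : set I) (f : I -> fps) (a : monom) :
  finite_set A -> (\sum_(i \in A) f i) a = \sum_(i \in A) f i a.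
Proof.
move=> fA; rewrite !fsbig_finite //.
by apply: (big_morph (fun g : fps => g a)).
Qed.

Section Main.
Variable m : nat.
Local Notation n := m.+2.
Variables (y : affperm n) (Fy : I_FPF y).

Lemma Pi_minus_side p : Pi_minus y p = Pi_side y p (-1).
Proof.
apply/seteqP; split=> z.
  move=> [_ [i [ip d1 d2 cv E]]]; have d1' : ~~ (n%:Z %| p - i)%Z by rewrite dvdzBC.
  exists i; split=> //; [by lia|exact/(covers_F_len ip d1' E)|by rewrite t_sym].
move=> [i [p1 d1 d2 lz E]]; split; first by rewrite E; exact: FPF_t.
have ip : i < p by lia.
have d1' : ~~ (n%:Z %| p - i)%Z by rewrite dvdzBC.
rewrite t_sym in E; exists i; split=> //; exact/(covers_F_len ip d1' E).
Qed.

Lemma Pi_plus_side q : Pi_plus y q = Pi_side y q 1.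
Proof.
apply/seteqP; split=> z.
  move=> [_ [j [qj d1 d2 cv E]]].
  exists j; split=> //; [by lia|exact/(covers_F_len qj d1 E)].
move=> [j [p1 d1 d2 lz E]]; split; first by rewrite E; exact: FPF_t.
have qj : q < j by lia.
by exists j; split=> //; exact/(covers_F_len qj d1 E).
Qed.

Lemma good_side_swap r s : good_side y (y r) s = good_side y r s.
Proof. by rewrite /good_side /covers_of FPF_K // setUC. Qed.

Lemma sum_F_FPF_side r s (a : monom) :
  (\sum_(z \in Pi_side y r s) F_FPF z) a =
  \sum_(z \in Pi_side y r s) \sum_(w \in atoms_FPF z) F_ w a.
Proof.
rewrite fps_sumE; last exact: finite_Pi_side.
apply: eq_fsbigr => z /set_mem /(Pi_side_FPF Fy) Fz.
by rewrite /F_FPF fps_sumE //; exact: finite_atoms.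
Qed.
End Main.

Theorem theorem5p8 (n : nat) (hn : (2 <= n)%N) (heven : ~~ odd n)
  (y : affperm n) (hy : I_FPF y) (p q : int) (hpq : p < q) (hqy : q = y p) :
  \sum_(z \in Pi_minus y p) F_FPF z = \sum_(z \in Pi_plus y q) F_FPF z.
Proof.
case: n hn heven y hy hqy => [//|[//|m]] _ _ y Fy ->.
rewrite Pi_minus_side // Pi_plus_side //; apply/funext => a.
rewrite !sum_F_FPF_side // -!sum_side //; [|by left|by right].
by rewrite good_side_swap // (sum_good_sides p Fy (c := fun w => F_ w a) (fun e v => chevalley_F e a v)).
Qed.
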